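(* Let $f:\mathbb{D}\to\mathbb{D}$ be holomorphic, and for $u\in\mathcal{H}(f)$ consider the weighted composition operator $$W_{u,f}h=u\,(h\circ f).$$ For every $u\in\mathcal{H}(f)$, the operator $W_{u,f}$ is bounded on $H^2$ and $$\|W_{u,f}\|\le\|u\|_{\mathcal{H}(f)}.$$ If $\{u_\alpha\}_{\alpha\ge1}$ is an orthonormal basis of $\mathcal{H}(f)$, then $$\Phi_f(S)=\sum_{\alpha\ge1}W_{u_\alpha,f}\,S\,W_{u_\alpha,f}^{*},\qquad S\in B(H^2),$$ and $$\sum_{\alpha\ge1}W_{u_\alpha,f}W_{u_\alpha,f}^{*}=I.$$ Both sums converge in the strong operator topology.
   Context: All inner products are linear in the second variable. $\mathbb{D}$ is the open unit disk, $H^2$ its Hardy space with Szegő kernel $k(z,w)=\frac{1}{1-z\overline w}$, $k_w=k(\cdot,w)$, so $h(w)=\langle k_w,h\rangle$ for $h\in H^2$. The kernel $c_f(z,w)=\frac{1-f(z)\overline{f(w)}}{1-z\overline w}$ is positive definite on $\mathbb{D}$; its reproducing kernel Hilbert space is the de Branges-Rovnyak space $\mathcal{H}(f)$ (a separable Hilbert space of functions on $\mathbb{D}$, possibly finite dimensional, in which case the sums are finite), and $c_{f,w}=c_f(\cdot,w)$, so $u(w)=\langle c_{f,w},u\rangle_{\mathcal{H}(f)}$. $V_f:H^2\to H^2\otimes\mathcal{H}(f)$ is the isometry determined by $V_fk_w=k_{f(w)}\otimes c_{f,w}$, $w\in\mathbb{D}$, and $\Phi_f(S)=V_f^{*}(S\otimes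 I_{\mathcal{H}(f)})V_f$ for $S\in B(H^2)$, a normal unital completely positive map. *)

(* Defs.v *)
From HB Require Import structures.
From mathcomp Require Import all_boot all_order all_algebra.
From mathcomp Require Import all_classical all_reals all_analysis.
From mathcomp Require Import complex ring lra.

Set Implicit Arguments.
Unset Strict Implicit.
Unset Printing Implicit Defensive.

Import Order.TTheory GRing.Theory Num.Theory.
Import numFieldNormedType.Exports.
Import complex Normc.

Local Open Scope classical_set_scope.
Local Open Scope ring_scope.
Local Open Scope complex_scope.

(* mathcomp-analysis puts the usual topology on numeric fields given by a
   structure variable; this gives it to the concrete type R[i] as well. *)
#[non_forgetful_inheritance]
HB.instance Definition _ (R : realType) := NormedModule.copy R[i] R[i]^o.

(** * Complex Hilbert spaces; the inner product is linear on the right *)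

HB.mixin Record isInnerProduct (R : realType) H & NormedModule R[i] H := {
  ip : H -> H -> R[i];
  ip_linear : forall (x : H) (a : R[i]) (y z : H),
    ip x (a *: y + z) = a * ip x y + ip x z;
  ip_conj : forall x y : H, ip y x = conjc (ip x y);
  ip_norm : forall x : H, ip x x = `|x| ^+ 2
}.

#[short(type="preHilbertType")]
HB.structure Definition PreHilbert (R : realType) :=
  {H of NormedModule R[i] H & isInnerProduct R H}.

#[short(type="hilbertType")]
HB.structure Definition Hilbert (R : realType) :=
  {H of PreHilbert R H & Complete H}.

Section complex_lemmas.
Variable R : realType.
Implicit Types z : R[i].

Lemma conjcMnorm z : conjc z * z = (normc z ^+ 2)%:C.
Proof.
case: z => a b; rewrite /= sqr_sqrtr ?addr_ge0 ?sqr_ge0 //; simpc.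
by rewrite -!expr2 mulrC subrr.
Qed.

Lemma normr_normc z : `|z| = (normc z)%:C.
Proof. by []. Qed.

Lemma normc_ge0 z : 0 <= normc z.
Proof. by case: z => a b; exact: sqrtr_ge0. Qed.

Lemma normc_conjc z : normc (conjc z) = normc z.
Proof. by case: z => a b; rewrite /= sqrrN. Qed.

Lemma ler_Re_normc z : `|Re z| <= normc z.
Proof.
by case: z => a b /=; rewrite -sqrtr_sqr ler_wsqrtr // lerDl sqr_ge0.
Qed.

Lemma ler_Im_normc z : `|Im z| <= normc z.
Proof.
by case: z => a b /=; rewrite -sqrtr_sqr ler_wsqrtr // lerDr sqr_ge0.
Qed.

Lemma ler_normc_ReIm z : normc z <= `|Re z| + `|Im z|.
Proof.
case: z => a b /=; rewrite -(@ler_pXn2r _ 2) ?nnegrE ?sqrtr_ge0 ?addr_ge0 //.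
rewrite sqr_sqrtr ?addr_ge0 ?sqr_ge0 // sqrrD !real_normK ?num_real //.
by rewrite lerD2r lerDl mulrn_wge0 // mulr_ge0.
Qed.

Lemma cvg_complex T (F : set_system T) {FF : Filter F} (u : T -> R[i]) (a b : R) :
  (fun t => Re (u t)) @ F --> a -> (fun t => Im (u t)) @ F --> b ->
  u @ F --> a +i* b.
Proof.
move=> /cvgrPdist_lt ha /cvgrPdist_lt hb; apply/cvgrPdist_lt => e e0.
have [Ie Re0] : Im e = 0 /\ 0 < Re e.
  by move: e0; rewrite ltcE /= => /andP[/eqP -> ->].
have e2 : 0 < Re e / 2 by rewrite divr_gt0.
near=> t; rewrite normr_normc ltcE /= Ie eqxx /=.
apply: (le_lt_trans (ler_normc_ReIm _)).
rewrite [ltRHS](splitr (Re e)) ltrD //.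
  suff : `|a - Re (u t)| < Re e / 2 by case: (u t).
  by near: t; exact: ha.
suff : `|b - Im (u t)| < Re e / 2 by case: (u t).
by near: t; exact: hb.
Unshelve. all: by end_near. Qed.

Lemma Re_sum (u : nat -> R[i]) (r : seq nat) :
  Re (\sum_(i <- r) u i) = \sum_(i <- r) Re (u i).
Proof.
by apply: (big_morph (@Re R)) => // -[a b] [c d].
Qed.

Lemma Im_sum (u : nat -> R[i]) (r : seq nat) :
  Im (\sum_(i <- r) u i) = \sum_(i <- r) Im (u i).
Proof.
by apply: (big_morph (@Im R)) => // -[a b] [c d].
Qed.

Lemma cvg_series_complex (u : nat -> R[i]) : cvgn (series (fun n => normc (u n))) ->
  series u @ \oo -->
  limn (series (fun n => Re (u n))) +i* limn (series (fun n => Im (u n))).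
Proof.
move=> cu; apply: cvg_complex.
  rewrite (_ : (fun _ => _) = series (fun n => Re (u n))); last first.
    by apply/funext => n; rewrite /series /= Re_sum.
  apply: normed_cvg; apply: series_le_cvg cu => n /=; rewrite ?normc_ge0 //.
  exact: ler_Re_normc.
rewrite (_ : (fun _ => _) = series (fun n => Im (u n))); last first.
  by apply/funext => n; rewrite /series /= Im_sum.
apply: normed_cvg; apply: series_le_cvg cu => n /=; rewrite ?normc_ge0 //.
exact: ler_Im_normc.
Qed.

Lemma is_cvg_series_complex (u : nat -> R[i]) :
  cvgn (series (fun n => normc (u n))) -> cvgn (series u).
Proof. by move=> /cvg_series_complex; apply: cvgP. Qed.

Lemma lim_series_conjc (u : nat -> R[i]) : cvgn (series (fun n => normc (u n))) ->
  limn (series (fun n => conjc (u n))) = conjc (limn (series u)).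
Proof.
move=> cu; rewrite (cvg_lim _ (cvg_series_complex cu)) //.
apply: cvg_lim => //.
have -> : (fun n => Im (u n)) = - (fun n => Im (conjc (u n))).
  by apply/funext => n /=; rewrite !fctE; case: (u n) => a b /=; rewrite opprK.
have cu' : cvgn (series (fun n => normc (conjc (u n)))).
  rewrite (_ : (fun n => normc (conjc (u n))) = (fun n => normc (u n))) //.
  by apply/funext => n /=; rewrite normc_conjc.
have ci : cvgn (series (fun n => Im (conjc (u n)))).
  apply: normed_cvg; apply: series_le_cvg cu' => n /=; rewrite ?normc_ge0 //.
  exact: ler_Im_normc.
rewrite lim_seriesN //= opprK.
rewrite (_ : (fun n => Re (u n)) = (fun n => Re (conjc (u n)))); last first.
  by apply/funext => n; case: (u n).
exact: cvg_series_complex.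
Qed.

End complex_lemmas.

(* A normed module structure built from a positive definite inner product. *)
HB.factory Record Lmodule_isPreHilbert (R : realType) H & GRing.Lmodule R[i] H := {
  dotp : H -> H -> R[i];
  dotp_linear : forall (x : H) (a : R[i]) (y z : H),
    dotp x (a *: y + z) = a * dotp x y + dotp x z;
  dotp_conj : forall x y : H, dotp y x = conjc (dotp x y);
  dotp_ge0 : forall x : H, 0 <= dotp x x;
  dotp_eq0 : forall x : H, dotp x x = 0 -> x = 0
}.

HB.builders Context R H & Lmodule_isPreHilbert R H.

Let dotp0 x : dotp x 0 = 0.
Proof.
have := dotp_linear x (-1) 0 0; rewrite scaler0 addr0 mulN1r addNr.
exact.
Qed.

Let dotpZ x a y : dotp x (a *: y) = a * dotp x y.
Proof. by have := dotp_linear x a y 0; rewrite addr0 dotp0 addr0. Qed.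

Let dotpD x y z : dotp x (y + z) = dotp x y + dotp x z.
Proof. by have := dotp_linear x 1 y z; rewrite scale1r mul1r. Qed.

Let dotpDl x y z : dotp (y + z) x = dotp y x + dotp z x.
Proof. by rewrite dotp_conj dotpD rmorphD /= -!dotp_conj. Qed.

Let dotpZl x a y : dotp (a *: y) x = conjc a * dotp y x.
Proof. by rewrite dotp_conj dotpZ rmorphM /= -dotp_conj. Qed.

Let nrm x : R[i] := (Num.sqrt (Re (dotp x x)))%:C.

Let dotpRe x : dotp x x = (Re (dotp x x))%:C.
Proof. by rewrite RRe_real // ger0_real // dotp_ge0. Qed.

Let Re_ge0 x : 0 <= Re (dotp x x).
Proof. by rewrite -lecR -dotpRe dotp_ge0. Qed.

Let nrm_sqr x : dotp x x = nrm x ^+ 2.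
Proof. by rewrite /nrm -rmorphXn sqr_sqrtr // -dotpRe. Qed.

Let cauchy_schwarz x y :
  normc (dotp x y) ^+ 2 <= Re (dotp x x) * Re (dotp y y).
Proof.
have [y0|y0] := eqVneq (dotp y y) 0.
  by rewrite y0 (dotp_eq0 y0) dotp0 normc0 expr0n /= mulr0.
have yy0 : 0 < Re (dotp y y).
  rewrite lt_neqAle Re_ge0 andbT; apply: contra_neq y0 => y0.
  by rewrite dotpRe -y0.
pose c : R[i] := - (dotp y x / dotp y y).
have := dotp_ge0 (c *: y + x).
have -> : dotp (c *: y + x) (c *: y + x) =
    dotp x x - conjc (dotp x y) * dotp x y / dotp y y.
  rewrite dotpD dotpZ !dotpDl !dotpZl.
  have cJ : conjc c = - (dotp x y / dotp y y).
    by rewrite /c rmorphN rmorphM /= conjc_inv -!dotp_conj.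
  rewrite cJ !mulNr mulfVK // addNr mulr0 oppr0 add0r.
  by rewrite (dotp_conj x y) [RHS]addrC -mulrA mulrCA mulrAC -mulrA mulrCA.
rewrite conjcMnorm (dotpRe x) {1}(dotpRe y) -fmorphV -rmorphM -rmorphB /= lecR.
by rewrite subr_ge0 ler_pdivrMr.
Qed.

Let nrmD x y : nrm (x + y) <= nrm x + nrm y.
Proof.
rewrite /nrm -rmorphD lecR -(@ler_pXn2r _ 2) ?nnegrE ?addr_ge0 ?sqrtr_ge0 //.
rewrite sqr_sqrtr // sqrrD !sqr_sqrtr // dotpD !dotpDl.
have -> : Re (dotp x x + dotp y x + (dotp x y + dotp y y)) =
   Re (dotp x x) + Re (dotp x y) *+ 2 + Re (dotp y y).
  rewrite (dotp_conj x y); case: (dotp x x) => ? ?; case: (dotp x y) => ? ?.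
  by case: (dotp y y) => ? ? /=; rewrite mulr2n !addrA.
rewrite lerD2r lerD2l ler_wMn2r // -sqrtrM //.
apply: (le_trans (ler_norm _)); apply: (le_trans (ler_Re_normc _)).
rewrite -[leLHS]ger0_norm ?normc_ge0 // -sqrtr_sqr ler_wsqrtr //.
Qed.

Let nrmZ (l : R[i]) x : nrm (l *: x) = `|l| * nrm x.
Proof.
rewrite /nrm dotpZ dotpZl mulrA [l * _]mulrC conjcMnorm {1}dotpRe -rmorphM /=.
by rewrite sqrtrM ?sqr_ge0 // sqrtr_sqr ger0_norm ?normc_ge0 // rmorphM.
Qed.

Let nrm_eq0 x : nrm x = 0 -> x = 0.
Proof.
by move=> n0; apply: dotp_eq0; rewrite nrm_sqr n0 expr0n.
Qed.

HB.instance Definition _ := Lmodule_isNormed.Build R[i] H nrmD nrmZ nrm_eq0.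
HB.instance Definition _ :=
  isInnerProduct.Build R H dotp_linear dotp_conj nrm_sqr.

HB.end.


(** * The Hardy space of the disk *)

(* An element is given by its square-summable Taylor coefficients at 0; the
   corresponding function on the disk is [hardy_eval] below. *)

Section hardy_space.
Variable R : realType.

Definition sqsummable : {pred nat -> R[i]} :=
  fun a => `[< cvgn (series (fun n => normc (a n) ^+ 2)) >].

Record hardy : Type := Hardy { coef :> nat -> R[i]; _ : coef \in sqsummable }.

HB.instance Definition _ := [isSub for coef].
HB.instance Definition _ := [Choice of hardy by <:].

Lemma coefP (a : hardy) : cvgn (series (fun n => normc (a n) ^+ 2)).
Proof. by have /asboolP := valP a. Qed.

Lemma sqsummable_le (a : nat -> R[i]) (v : nat -> R) :
  (forall n, normc (a n) ^+ 2 <= v n) -> cvgn (series v) -> a \in sqsummable.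
Proof.
move=> av cv; apply/asboolP; apply: series_le_cvg cv => // n; rewrite ?sqr_ge0 //.
by apply: le_trans (av n); exact: sqr_ge0.
Qed.

Lemma sqr_normcD_le (x y : R[i]) :
  normc (x + y) ^+ 2 <= 2 * normc x ^+ 2 + 2 * normc y ^+ 2.
Proof.
apply: (@le_trans _ _ ((normc x + normc y) ^+ 2)).
  by rewrite ler_pXn2r ?nnegrE ?addr_ge0 ?normc_ge0 ?le_normcD.
rewrite sqrrD -subr_ge0.
rewrite (_ : _ - _ = (normc x - normc y) ^+ 2) ?sqr_ge0 //.
by rewrite sqrrB !mulr_natl !mulr2n !opprD; ring.
Qed.

Lemma sqsummable_submod : submod_closed sqsummable.
Proof.
split.
  apply: (@sqsummable_le _ (fun=> 0)).
    by move=> n; rewrite normc0 expr0n.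
  apply/cvg_ex; exists 0; rewrite (_ : series _ = fun=> 0); first exact: cvg_cst.
  by apply/funext => n; rewrite /series /= big1.
move=> c a b /asboolP ca /asboolP cb.
apply: (@sqsummable_le _ ((2 * normc c ^+ 2) *: (fun n => normc (a n) ^+ 2) +
                          2 *: (fun n => normc (b n) ^+ 2))).
  move=> n; apply: (le_trans (sqr_normcD_le _ _)).
  by rewrite normcM exprMn mulrA.
by apply: is_cvg_seriesD; apply: is_cvg_seriesZ.
Qed.

HB.instance Definition _ := GRing.isSubmodClosed.Build R[i] (nat -> R[i])
  sqsummable sqsummable_submod.
HB.instance Definition _ := [SubChoice_isSubLmodule of hardy by <:].

Lemma hardyD (a b : hardy) n : (a + b) n = a n + b n.
Proof. by []. Qed.

Lemma hardyB (a b : hardy) n : (a - b) n = a n - b n.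
Proof. by []. Qed.

Lemma hardyZ c (a : hardy) n : (c *: a) n = c * a n.
Proof. by []. Qed.

Lemma hardy_series_normc (a b : hardy) :
  cvgn (series (fun n => normc (conjc (a n) * b n))).
Proof.
apply: (@series_le_cvg _ _ ((fun n => normc (a n) ^+ 2) +
                            (fun n => normc (b n) ^+ 2))).
- by move=> n; exact: normc_ge0.
- by move=> n; apply: addr_ge0; exact: sqr_ge0.
- move=> n; rewrite normcM normc_conjc -[leRHS]/(_ + _).
  have : 0 <= (normc (a n) - normc (b n)) ^+ 2 + normc (a n) * normc (b n) *+ 0.
    by rewrite addr_ge0 ?sqr_ge0.
  have := mulr_ge0 (normc_ge0 (a n)) (normc_ge0 (b n)).
  by nra.
- by apply: is_cvg_seriesD; exact: coefP.
Qed.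

Definition hardy_ip (a b : hardy) : R[i] :=
  limn (series (fun n => conjc (a n) * b n)).

Lemma hardy_ip_cvg (a b : hardy) :
  series (fun n => conjc (a n) * b n) @ \oo --> hardy_ip a b.
Proof. by apply: is_cvg_series_complex; exact: hardy_series_normc. Qed.

Lemma hardy_ip_linear (x : hardy) (c : R[i]) (y z : hardy) :
  hardy_ip x (c *: y + z) = c * hardy_ip x y + hardy_ip x z.
Proof.
apply: cvg_lim => //.
rewrite (_ : series _ = (fun n => c * series (fun n => conjc (x n) * y n) n +
                               series (fun n => conjc (x n) * z n) n)).
  apply: cvgD; last exact: hardy_ip_cvg.
  by apply: cvgMl_tmp; exact: hardy_ip_cvg.
apply/funext => n; rewrite /series /= mulr_sumr -big_split /=.
apply: eq_bigr => i _; transitivity (conjc (x i) * (c * y i + z i)) => //.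
by rewrite mulrDr mulrCA.
Qed.

Lemma hardy_ip_conj (x y : hardy) : hardy_ip y x = conjc (hardy_ip x y).
Proof.
rewrite /hardy_ip -lim_series_conjc; last exact: hardy_series_normc.
congr (limn (series _)); apply/funext => n.
by rewrite rmorphM /= conjcK mulrC.
Qed.

Lemma hardy_ip_sqr (x : hardy) :
  hardy_ip x x = (limn (series (fun n => normc (x n) ^+ 2)))%:C.
Proof.
apply: cvg_lim => //; rewrite -complexr0.
rewrite (_ : (fun _ => _) = fun n => (normc (x n) ^+ 2)%:C); last first.
  by apply/funext => n; rewrite conjcMnorm.
apply: cvg_complex.
  rewrite (_ : (fun _ => _) = series (fun n => normc (x n) ^+ 2)).
    exact: coefP.
  by apply/funext => n; rewrite /series /= Re_sum.
rewrite (_ : (fun _ => _) = fun=> 0); first exact: cvg_cst.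
by apply/funext => n; rewrite /series /= Im_sum big1.
Qed.

Lemma sqr_normc_partial (x : hardy) N :
  \sum_(0 <= n < N) normc (x n) ^+ 2 <=
  limn (series (fun n => normc (x n) ^+ 2)).
Proof.
apply: (@nondecreasing_cvgn_le _ (series (fun n => normc (x n) ^+ 2))).
  by apply: nondecreasing_series => n _ _; exact: sqr_ge0.
exact: coefP.
Qed.

Lemma sqr_normc_le (x : hardy) n :
  normc (x n) ^+ 2 <= limn (series (fun n => normc (x n) ^+ 2)).
Proof.
apply: le_trans (sqr_normc_partial x n.+1).
by rewrite big_nat_recr //= lerDr sumr_ge0 // => i _; exact: sqr_ge0.
Qed.

Lemma hardy_ip_ge0 (x : hardy) : 0 <= hardy_ip x x.
Proof.
rewrite hardy_ip_sqr ler0c; apply: le_trans (sqr_normc_le x 0%N).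
exact: sqr_ge0.
Qed.

Lemma hardy_ip_eq0 (x : hardy) : hardy_ip x x = 0 -> x = 0.
Proof.
rewrite hardy_ip_sqr => -[x0]; apply: val_inj; apply/funext => n /=.
have := sqr_normc_le x n; rewrite x0 => h.
have /eqP : normc (x n) ^+ 2 = 0.
  by apply/eqP; rewrite eq_le h sqr_ge0.
by rewrite sqrf_eq0 => /eqP /eq0_normc.
Qed.

HB.instance Definition _ := Lmodule_isPreHilbert.Build R hardy
  hardy_ip_linear hardy_ip_conj hardy_ip_ge0 hardy_ip_eq0.

Lemma hardy_norm_sqr (x : hardy) :
  `|x| ^+ 2 = (limn (series (fun n => normc (x n) ^+ 2)))%:C.
Proof. by rewrite -hardy_ip_sqr -[RHS]/(ip x x) ip_norm. Qed.

Lemma Re_norm_ge0 (V : normedModType R[i]) (x : V) : 0 <= Re `|x|.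
Proof. by have := normr_ge0 x; rewrite lecE /= => /andP[]. Qed.

Lemma Re_normE (V : normedModType R[i]) (x : V) : `|x| = (Re `|x|)%:C.
Proof. by rewrite RRe_real // normr_real. Qed.

Lemma hardy_Re_norm (x : hardy) :
  Re `|x| = Num.sqrt (limn (series (fun n => normc (x n) ^+ 2))).
Proof.
by rewrite -[LHS]/(Num.sqrt (Re (hardy_ip x x))) hardy_ip_sqr.
Qed.

Lemma normc_coef_le (x : hardy) n : normc (x n) <= Re `|x|.
Proof.
rewrite hardy_Re_norm -[leLHS]ger0_norm ?normc_ge0 // -sqrtr_sqr ler_wsqrtr //.
exact: sqr_normc_le.
Qed.

Lemma hardy_complete (F : set_system hardy) :
  ProperFilter F -> cauchy F -> cvg F.
Proof.
move=> FF cF.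
have lip_cvg (p : hardy -> R) :
    (forall x y, `|p x - p y| <= Re `|x - y|) -> cvg (p @ F).
  move=> lp; apply: cauchy_cvg; apply/cauchyP => e e0.
  have /cauchyP := cF => /(_ e%:C); rewrite ltcR => /(_ e0)[x Fx].
  exists (p x); suff : F (p @^-1` ball (p x) e) by [].
  apply: filterS Fx => y xy.
  have {}xy : `|x - y| < e%:C by move: xy; rewrite -ball_normE.
  rewrite -ball_normE /=; apply: (le_lt_trans (lp _ _)).
  by rewrite -ltcR -Re_normE.
have cRe n : cvg ((fun x : hardy => Re (x n)) @ F).
  apply: lip_cvg => x y; apply: le_trans (normc_coef_le _ n).
  apply: le_trans (ler_Re_normc _).
  by rewrite hardyB; case: (x n) => ? ?; case: (y n).
have cIm n : cvg ((fun x : hardy => Im (x n)) @ F).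
  apply: lip_cvg => x y; apply: le_trans (normc_coef_le _ n).
  apply: le_trans (ler_Im_normc _).
  by rewrite hardyB; case: (x n) => ? ?; case: (y n).
pose b n : R[i] := lim ((fun x : hardy => Re (x n)) @ F) +i*
                   lim ((fun x : hardy => Im (x n)) @ F).
have sqrnE (z : R[i]) : normc z ^+ 2 = Re z ^+ 2 + Im z ^+ 2.
  by case: z => u v; rewrite /= sqr_sqrtr ?addr_ge0 ?sqr_ge0.
have key (x : hardy) (e : R) : 0 < e -> F (ball x e%:C) -> forall N,
    \sum_(0 <= n < N) normc (b n - x n) ^+ 2 <= e ^+ 2.
  move=> e0 Fx N.
  have cS : (fun y : hardy => \sum_(0 <= n < N) normc (y n - x n) ^+ 2) @ F -->
      \sum_(0 <= n < N) normc (b n - x n) ^+ 2.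
    elim: N => [|N IH].
      rewrite big_nil (_ : (fun _ => _) = fun=> 0); first exact: cvg_cst.
      by apply/funext => y; rewrite big_nil.
    rewrite big_nat_recr //= (_ : (fun _ => _) = fun y : hardy =>
      \sum_(0 <= n < N) normc (y n - x n) ^+ 2 + normc (y N - x N) ^+ 2).
      apply: cvgD => //.
      rewrite sqrnE (_ : (fun _ => _) = fun y : hardy =>
        (Re (y N) - Re (x N)) ^+ 2 + (Im (y N) - Im (x N)) ^+ 2).
        have -> : Re (b N - x N) = Re (b N) - Re (x N) by case: (x N).
        have -> : Im (b N - x N) = Im (b N) - Im (x N) by case: (x N).
        apply: cvgD; rewrite !expr2; apply: cvgM; apply: cvgB;
          by [exact: cRe|exact: cIm|exact: cvg_cst].
      apply/funext => y; rewrite sqrnE.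
      by case: (y N) => ? ?; case: (x N).
    by apply/funext => y; rewrite big_nat_recr.
  rewrite -(cvg_lim _ cS) //; apply: limr_le; first exact: cvgP cS.
  apply: filterS Fx => y xy.
  have {}xy : `|x - y| < e%:C by move: xy; rewrite -ball_normE.
  apply: (@le_trans _ _ (\sum_(0 <= n < N) normc ((y - x) n) ^+ 2)).
    by apply: ler_sum => n _; rewrite hardyB.
  apply: (le_trans (sqr_normc_partial _ _)); rewrite -lecR -hardy_norm_sqr.
  rewrite rmorphXn /= ler_pXn2r ?nnegrE ?normr_ge0 ?ler0c 1?ltW //.
  by rewrite distrC.
have b_sq (x : hardy) (e : R) : 0 < e -> F (ball x e%:C) ->
    (b \- x : nat -> R[i]) \in sqsummable.
  move=> e0 Fx; apply/asboolP; apply: nondecreasing_is_cvgn.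
    by apply: nondecreasing_series => n _ _; exact: sqr_ge0.
  by exists (e ^+ 2) => _ [N _ <-]; exact: key.
have [x0 Fx0] : exists x, F (ball x 1%:C).
  by have /cauchyP := cF; apply; rewrite ltr01.
have bS : b \in sqsummable.
  have bE : b = (b \- x0) + coef x0.
    by apply/funext => n; rewrite !fctE /= subrK.
  by rewrite bE rpredD ?(b_sq _ _ _ Fx0) //; case: (x0).
pose B := Hardy bS.
apply/cvg_ex; exists B; apply/cvgrPdist_le => e e0.
have [Ie Re0] : Im e = 0 /\ 0 < Re e.
  by move: e0; rewrite ltcE /= => /andP[/eqP -> ->].
have eE : e = (Re e)%:C by case: (e) Ie => ? ? /= ->.
pose d := Re e / 2; have d0 : 0 < d by rewrite divr_gt0.
have /cauchyP := cF => /(_ d%:C); rewrite ltcR => /(_ d0)[x Fx].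
have Bx : `|B - x| <= d%:C.
  have d0' : 0 <= d%:C by rewrite ler0c ltW.
  rewrite -(@ler_pXn2r _ 2) ?nnegrE // hardy_norm_sqr -rmorphXn lecR.
  apply: limr_le; first exact: coefP.
  by apply: nearW => N; exact: key.
apply: filterS Fx => y xy.
have {}xy : `|x - y| < d%:C by move: xy; rewrite -ball_normE.
rewrite -[B - y](subrKA x); apply: (le_trans (ler_normD _ _)).
rewrite eE [Re e](splitr (Re e)) rmorphD lerD // ltW //.
Qed.

HB.instance Definition _ := Uniform_isComplete.Build hardy hardy_complete.

End hardy_space.


(** * Reproducing kernel Hilbert spaces *)

(* A Hilbert space of functions on X with reproducing kernel K: its elements
   are identified with functions through the injective linear map [feval], and
   [kfun w] is the element K(., w).  Such a space is determined by K. *)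
Record rkhs (R : realType) (X : Type) (K : X -> X -> R[i]) := Rkhs {
  rkhs_sort :> hilbertType R;
  feval : rkhs_sort -> X -> R[i];
  kfun : X -> rkhs_sort;
  feval_linear : forall x a (g h : rkhs_sort),
    feval (a *: g + h) x = a * feval g x + feval h x;
  feval_inj : injective feval;
  feval_kfun : forall w z, feval (kfun w) z = K z w;
  feval_reproducing : forall w h, feval h w = ip (kfun w) h
}.
Arguments kfun {R X K} _ _.

Definition disk (R : realType) := {z : R[i] | `|z| < 1}.

Definition szego (R : realType) (z w : disk R) : R[i] :=
  1 / (1 - val z * conjc (val w)).

Section hardy_rkhs.
Variable R : realType.

Definition hardy_eval (a : hardy R) (z : disk R) : R[i] :=
  limn (series (fun n => a n * val z ^+ n)).

Lemma normc_disk (w : disk R) : normc (val w) < 1.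
Proof. by rewrite -ltcR -normr_normc; exact: (valP w). Qed.

Lemma normcX (z : R[i]) n : normc (z ^+ n) = normc z ^+ n.
Proof.
elim: n => [|n IH]; first by rewrite !expr0 normc1.
by rewrite !exprS normcM IH.
Qed.

Lemma szego_vec_sqsummable (w : disk R) :
  (fun n => conjc (val w) ^+ n) \in @sqsummable R.
Proof.
apply: (@sqsummable_le _ _ (geometric 1 (normc (val w) ^+ 2))).
  by move=> n; rewrite normcX normc_conjc /= mul1r exprAC.
apply: is_cvg_geometric_series.
rewrite ger0_norm ?sqr_ge0 // expr_lt1 ?normc_ge0 //; exact: normc_disk.
Qed.

Definition szego_vec (w : disk R) : hardy R := Hardy (szego_vec_sqsummable w).

Lemma hardy_reproducing (w : disk R) (h : hardy R) :
  hardy_eval h w = ip (szego_vec w) h.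
Proof.
rewrite -[RHS]/(hardy_ip _ _) /hardy_eval /hardy_ip; congr (limn (series _)).
by apply/funext => n; rewrite /= rmorphXn /= conjcK mulrC.
Qed.

Lemma hardy_eval_linear (z : disk R) (a : R[i]) (g h : hardy R) :
  hardy_eval (a *: g + h) z = a * hardy_eval g z + hardy_eval h z.
Proof. by rewrite !hardy_reproducing ip_linear. Qed.

Lemma hardy_eval_cvg (a : hardy R) (z : disk R) :
  series (fun n => a n * val z ^+ n) @ \oo --> hardy_eval a z.
Proof.
rewrite hardy_reproducing (_ : (fun n => _) =
  (fun n => conjc (szego_vec z n) * a n)); first exact: hardy_ip_cvg.
by apply/funext => n; rewrite /= rmorphXn /= conjcK mulrC.
Qed.

Lemma hardy_eval_eq0 (a : hardy R) : (forall z, hardy_eval a z = 0) -> a = 0.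
Proof.
move=> a0; pose M := Re `|a|.
have M0 : 0 <= M by exact: Re_norm_ge0.
have aM n : normc (a n) <= M by exact: normc_coef_le.
suff aN N : a N = 0 by apply: val_inj; apply/funext => n; exact: aN.
elim/ltn_ind : N => N IH; apply: eq0_normc; apply/eqP; rewrite eq_le normc_ge0 andbT.
have small (r : R) : 0 < r -> r <= 2^-1 -> normc (a N) <= 2 * M * r.
  move=> r0 r2.
  have rD : `|r%:C : R[i]| < 1.
    by rewrite normr_normc ltcR /= expr0n addr0 sqrtr_sqr gtr0_norm //; lra.
  pose z : disk R := exist _ r%:C rD.
  pose S m := \sum_(0 <= k < m) a (N + k.+1)%N * r%:C ^+ k.
  have SM m : normc (S m) <= M * (2 - 2 * 2^-1 ^+ m).
    elim: m => [|m IHm]; first by rewrite /S big_nil normc0 expr0 mulr1 subrr mulr0.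
    rewrite /S big_nat_recr //= (le_trans (le_normcD _ _)) //.
    have : normc (a (N + m.+1)%N * r%:C ^+ m) <= M * 2^-1 ^+ m.
      rewrite normcM normcX /= expr0n addr0 sqrtr_sqr gtr0_norm //.
      apply: ler_pM => //; first exact: normc_ge0.
        by rewrite exprn_ge0 // ltW.
      by rewrite lerXn2r ?nnegrE ?invr_ge0 ?ler0n // ltW.
    by move: IHm; rewrite /S exprS; lra.
  have cS : (fun m => a N + r%:C * S m) @ \oo --> (0 : R[i]).
    have := @hardy_eval_cvg a z; rewrite a0 -(cvg_shiftn N.+1) => cz.
    have rN0 : r%:C ^+ N != 0 :> R[i].
      by rewrite expf_neq0 // -[0]/(0%:C) (inj_eq (@complexI R)) gt_eqF.
    rewrite -(mulr0 (r%:C ^+ N)^-1).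
    rewrite (_ : (fun m => _) = fun m => (r%:C ^+ N)^-1 *
        series (fun n => a n * val z ^+ n) (m + N.+1)%N); first exact: cvgMl_tmp.
    apply/funext => m; apply: (mulfI rN0); rewrite mulrA mulfV // mul1r.
    rewrite /series /=; elim: m => [|m IHm].
      rewrite /S big_nil mulr0 addr0 add0n big_nat_recr //= big_nat_cond big1.
        by rewrite add0r mulrC.
      by move=> k /andP[/IH -> _]; rewrite mul0r.
    rewrite addSn big_nat_recr //= -IHm /S big_nat_recr //= -/(S m).
    have -> : (m + N.+1 = N + m.+1)%N by rewrite addnC addSnnS.
    by rewrite exprD exprS; ring.
  apply/ler_addgt0Pr => e e0.
  move/cvgrPdist_lt : cS => /(_ e%:C); rewrite ltcR => /(_ e0)[m _ /(_ m (leqnn m))] /=.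
  rewrite sub0r normrN normr_normc ltcR => aS.
  have rS : normc (r%:C * S m) <= 2 * M * r.
    rewrite normcM /= expr0n addr0 sqrtr_sqr gtr0_norm // mulrC ler_pM2r //.
    apply: (le_trans (SM m)); rewrite mulrC ler_wpM2r //.
    by rewrite gerBl mulr_ge0 // exprn_ge0.
  rewrite -[a N](addrK (r%:C * S m)) (le_trans (le_normcD _ _)) //.
  by rewrite normcN addrC lerD // ltW.
rewrite leNgt; apply/negP => x0.
have M4 : 0 < 4 * M + 4 by lra.
pose r := Num.min 2^-1 (normc (a N) / (4 * M + 4)).
have r0 : 0 < r by rewrite lt_min invr_gt0 ltr0n /= divr_gt0.
have r2 : r <= 2^-1 by rewrite ge_min lexx.
have r3 : (4 * M + 4) * r <= normc (a N).
  by rewrite mulrC -ler_pdivlMr // ge_min lexx orbT.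
have := small r r0 r2.
by have := mulr_ge0 M0 (ltW r0); nra.
Qed.

Lemma hardy_eval_inj : injective hardy_eval.
Proof.
move=> g h gh; apply/eqP; rewrite -subr_eq0; apply/eqP/hardy_eval_eq0 => z.
by rewrite addrC -scaleN1r hardy_eval_linear gh mulN1r addNr.
Qed.

Lemma szego_vecE (w z : disk R) : hardy_eval (szego_vec w) z = szego z w.
Proof.
rewrite /szego div1r; apply: cvg_lim => //.
set q := val z * conjc (val w).
have q1 : normc q < 1.
  by rewrite normcM normc_conjc mulr_ilt1 ?normc_ge0 ?normc_disk.
have q0 : 1 - q != 0.
  rewrite subr_eq0; apply/negP => /eqP q1E.
  by move: q1; rewrite -q1E normc1 ltxx.
rewrite (_ : series _ = fun n => (1 - q ^+ n) * (1 - q)^-1); last first.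
  apply/funext => n; apply: (mulIf q0); rewrite mulfVK //.
  rewrite -[in RHS](expr1n _ n) subrXX mulrC /series /= big_mkord; congr (_ * _).
  apply: eq_bigr => i _; rewrite expr1n mul1r /q exprMn mulrC //.
rewrite -[X in _ --> X]mul1r -[X in X * _]subr0.
apply: cvgMr_tmp; apply: cvgB; first exact: cvg_cst.
apply/cvgrPdist_lt => e e0.
have [Ie Re0] : Im e = 0 /\ 0 < Re e.
  by move: e0; rewrite ltcE /= => /andP[/eqP -> ->].
have /cvgrPdist_lt/(_ _ Re0) : (fun n => normc q ^+ n) @ \oo --> (0 : R).
  by apply: cvg_expr; rewrite ger0_norm ?normc_ge0.
apply: filterS => n.
rewrite !sub0r !normrN normr_normc ger0_norm ?exprn_ge0 ?normc_ge0 // => qn.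
by rewrite ltcE /= Ie eqxx normcX.
Qed.

Definition hardy_rkhs : rkhs (@szego R) :=
  @Rkhs R (disk R) (@szego R) (hardy R) hardy_eval szego_vec
    hardy_eval_linear hardy_eval_inj szego_vecE hardy_reproducing.

End hardy_rkhs.


(** * Bounded operators *)

Section operators.
Variable R : realType.
Implicit Types H K : hilbertType R.

Definition bounded_op H K (A : H -> K) : Prop :=
  linear A /\ exists M : R, forall x, `|A x| <= M%:C * `|x|.

(* `|x| lies in R[i]; this is the same nonnegative number in R. *)
Definition hnorm H (x : H) : R := Re `|x|.

Definition opnorm H K (A : H -> K) : R :=
  sup [set hnorm (A x) | x in [set x : H | hnorm x <= 1]].

(* [xget x0 P] is an element of P if there is one, and x0 otherwise. *)
Definition adjoint H K (A : H -> K) (y : K) : H :=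
  xget 0 [set z | forall x, ip z x = ip y (A x)].

Definition lspan H (D : set H) : set H :=
  [set x | exists (n : nat) (c : 'I_n -> R[i]) (v : 'I_n -> H),
     (forall i, D (v i)) /\ x = \sum_i c i *: v i].

(* Countable families, possibly finite: the indices are the n < N when
   d = Some N, and all n when d = None. *)
Definition index_below (d : option nat) (n : nat) : bool :=
  if d is Some N then (n < N)%N else true.

Definition orthonormal_basis H (d : option nat) (u : nat -> H) : Prop :=
  (forall i j, index_below d i -> index_below d j ->
     ip (u i) (u j) = (i == j)%:R) /\
  dense (lspan [set u n | n in [set n | index_below d n]]).

Definition sot_sum H (d : option nat) (A : nat -> H -> H) (B : H -> H) : Prop :=
  forall x : H,
    (fun n => \sum_(0 <= i < n | index_below d i) A i x) @ \oo --> B x.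

End operators.

(* A Hilbert space tensor product, unique up to a unitary preserving [tens]. *)
Record hilbert_tensor (R : realType) (H K : hilbertType R) := HilbertTensor {
  tensor_sort :> hilbertType R;
  tens : H -> K -> tensor_sort;
  tens_linearl : forall (y : K), linear (tens ^~ y);
  tens_linearr : forall (x : H), linear (tens x);
  tens_ip : forall x x' y y', ip (tens x y) (tens x' y') = ip x x' * ip y y';
  tens_dense : dense (lspan [set tens xy.1 xy.2 | xy in [set: H * K]])
}.
Arguments tens {R H K} _ _ _.

(* S (x) I: the bounded operator sending x (x) y to S x (x) y. *)
Definition ampliation (R : realType) (H K : hilbertType R)
    (T : hilbert_tensor H K) (S : H -> H) : T -> T :=
  xget (fun=> 0) [set A : T -> T |
    bounded_op A /\ forall x y, A (tens T x y) = tens T (S x) y].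

(** * De Branges-Rovnyak spaces and weighted composition operators *)

Section de_branges_rovnyak.
Variable R : realType.

Definition disk_extension (g : disk R -> R[i]) (z : R[i]) : R[i] :=
  if insub z is Some w then g w else 0.

Definition holomorphic (g : disk R -> R[i]) : Prop :=
  forall z : disk R, derivable (disk_extension g) (val z) 1.

Definition dbr_kernel (f : disk R -> disk R) (z w : disk R) : R[i] :=
  (1 - val (f z) * conjc (val (f w))) / (1 - val z * conjc (val w)).

Variables (f : disk R -> disk R) (Hf : rkhs (dbr_kernel f)).

(* The space H(f) is Hf: the Hilbert space of functions on the disk with
   reproducing kernel [dbr_kernel f].  H^2 is [hardy_rkhs R], i.e. [hardy R]
   with its evaluation and its Szego kernel functions. *)

Definition weighted_comp (u : Hf) (h : hardy_rkhs R) : hardy_rkhs R :=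
  xget 0 [set g | forall z, feval g z = feval u z * feval h (f z)].

Variable T : hilbert_tensor (hardy_rkhs R) Hf.

Definition dbr_isometry : hardy_rkhs R -> T :=
  xget (fun=> 0) [set V : hardy_rkhs R -> T | [/\ linear V,
    forall h, `|V h| = `|h| &
    forall w, V (kfun (hardy_rkhs R) w) =
              tens T (kfun (hardy_rkhs R) (f w)) (kfun Hf w)]].

Definition dbr_cp (S : hardy_rkhs R -> hardy_rkhs R) :
    hardy_rkhs R -> hardy_rkhs R :=
  adjoint dbr_isometry \o ampliation S \o dbr_isometry.

End de_branges_rovnyak.

(* Main.v *)
Require Import Defs.
From mathcomp Require Import all_boot all_order all_algebra.
From mathcomp Require Import all_classical all_reals all_analysis.
From mathcomp Require Import complex ring lra.

Import Order.TTheory GRing.Theory Num.Theory.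
Import numFieldNormedType.Exports.

Local Open Scope classical_set_scope.
Local Open Scope ring_scope.

(** On kernels [W_u^* k_w = conj (u w) k_{f w}], and the factorisation
    [k(z, w) = k(f z, f w) c_f(z, w)] turns the norm of a combination of kernels
    into a Gram sum [sum_ij <x_i, x_j> <y_i, y_j>] with [x_i] in [H^2] and [y_i]
    in [H(f)].  Boundedness of [W_u^*], hence of its adjoint [W_u], is then the
    Schur product inequality
    [|sum_i <u, y_i> x_i|^2 <= |u|^2 sum_ij <x_i, x_j> <y_i, y_j>], obtained by
    applying Cauchy-Schwarz in [H(f)] to each Taylor coefficient.  For an
    orthonormal basis [u_a], Parseval gives equality after summing the left-hand
    sides over [a]; so [sum_a |B_a x|^2 = |x|^2] on a dense set, both for
    [B_a = W_{u_a}^*] on [H^2] and for [B_a = E_a^*] on [H^2 (x) H(f)], where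
    [E_a x = x (x) u_a], and this alone implies [sum_a B_a^* B_a = I] strongly.
    The formula for [Phi_f] follows from [W_{u_a} = V_f^* E_a] and
    [E_a S = (S (x) I) E_a]. *)

Section hilbert_space.
Import complex Normc.
Local Open Scope complex_scope.
Local Set Implicit Arguments.
Local Unset Strict Implicit.
Variable R : realType.
Implicit Types H K : hilbertType R.

(** * Inner products and norms *)

Lemma ipDr H (x y z : H) : ip x (y + z) = ip x y + ip x z.
Proof. by rewrite -{1}[y]scale1r ip_linear mul1r. Qed.

Lemma ip0r H (x : H) : ip x 0 = 0.
Proof. by apply: (@addrI _ (ip x 0)); rewrite -ipDr !addr0. Qed.

Lemma ipZr H a (x y : H) : ip x (a *: y) = a * ip x y.
Proof. by rewrite -[a *: y]addr0 ip_linear ip0r addr0. Qed.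

Lemma ipNr H (x y : H) : ip x (- y) = - ip x y.
Proof. by rewrite -scaleN1r ipZr mulN1r. Qed.

Lemma ipBr H (x y z : H) : ip x (y - z) = ip x y - ip x z.
Proof. by rewrite ipDr ipNr. Qed.

Lemma ipDl H (x y z : H) : ip (y + z) x = ip y x + ip z x.
Proof. by rewrite ip_conj ipDr rmorphD /= -!ip_conj. Qed.

Lemma ipZl H a (x y : H) : ip (a *: y) x = conjc a * ip y x.
Proof. by rewrite ip_conj ipZr rmorphM /= -ip_conj. Qed.

Lemma ipNl H (x y : H) : ip (- y) x = - ip y x.
Proof. by rewrite ip_conj ipNr rmorphN /= -ip_conj. Qed.

Lemma ip0l H (x : H) : ip 0 x = 0.
Proof. by rewrite ip_conj ip0r rmorph0. Qed.

Lemma ipBl H (x y z : H) : ip (y - z) x = ip y x - ip z x.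
Proof. by rewrite ipDl ipNl. Qed.

Lemma ip_sumr H I (r : seq I) (P : pred I) (F : I -> H) (x : H) :
  ip x (\sum_(i <- r | P i) F i) = \sum_(i <- r | P i) ip x (F i).
Proof. by apply: (big_morph (ip x)) => [y z|]; rewrite ?ipDr ?ip0r. Qed.

Lemma ip_suml H I (r : seq I) (P : pred I) (F : I -> H) (x : H) :
  ip (\sum_(i <- r | P i) F i) x = \sum_(i <- r | P i) ip (F i) x.
Proof.
by apply: (big_morph (fun y => ip y x)) => [y z|]; rewrite ?ipDl ?ip0l.
Qed.

Lemma normE H (x : H) : `|x| = (hnorm x)%:C.
Proof. exact: Re_normE. Qed.

Lemma hnorm_ge0 H (x : H) : 0 <= hnorm x.
Proof. exact: Re_norm_ge0. Qed.

Lemma ip_hnorm H (x : H) : ip x x = (hnorm x ^+ 2)%:C.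
Proof. by rewrite ip_norm normE rmorphXn. Qed.

Lemma hnorm_sqr H (x : H) : hnorm x ^+ 2 = Re (ip x x).
Proof. by rewrite ip_hnorm. Qed.

Lemma hnorm0 H : hnorm (0 : H) = 0.
Proof. by rewrite /hnorm normr0. Qed.

Lemma hnorm0_eq0 H (x : H) : hnorm x = 0 -> x = 0.
Proof. by move=> x0; apply/normr0_eq0; rewrite normE x0. Qed.

Lemma ip_ext H (x y : H) : (forall z, ip z x = ip z y) -> x = y.
Proof.
move=> xy; apply/eqP; rewrite -subr_eq0; apply/eqP/hnorm0_eq0/eqP.
by rewrite -sqrf_eq0 hnorm_sqr ipBr xy subrr.
Qed.

Lemma ler_hnormD H (x y : H) : hnorm (x + y) <= hnorm x + hnorm y.
Proof. by rewrite -lecR rmorphD /= -!normE ler_normD. Qed.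

Lemma hnormN H (x : H) : hnorm (- x) = hnorm x.
Proof. by rewrite /hnorm normrN. Qed.

Lemma hnormZ H a (x : H) : hnorm (a *: x) = normc a * hnorm x.
Proof.
apply: (@complexI R); rewrite rmorphM /= -normE normrZ -normr_normc.
by rewrite -normE.
Qed.

Lemma hdistrC H (x y : H) : hnorm (x - y) = hnorm (y - x).
Proof. by rewrite -hnormN opprB. Qed.

Lemma hnormB_sqr H (x y : H) :
  hnorm (x - y) ^+ 2 =
  hnorm x ^+ 2 - 2 * Re (ip x y) + hnorm y ^+ 2.
Proof.
rewrite !hnorm_sqr ipBr !ipBl (ip_conj x y).
by move: (ip x x) (ip x y) (ip y y) => [a b] [c d] [e g] /=; ring.
Qed.

(** The subtracted vector is the best approximation of [x] by a multiple of [y]. Nonnegativity of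
    the residual gives Cauchy-Schwarz, and its exact size drives the minimisation in
    [orthogonal_projection]. *)
Lemma hnorm_proj_sqr H (x y : H) : hnorm y != 0 ->
  hnorm (x - (ip y x / ip y y) *: y) ^+ 2 =
  hnorm x ^+ 2 - normc (ip y x) ^+ 2 / hnorm y ^+ 2.
Proof.
move=> y0; have n0 : (hnorm y ^+ 2)%:C != 0 :> R[i].
  by rewrite -[0]/(0%:C) (inj_eq (@complexI R)) expf_neq0.
have qE : (normc (ip y x) ^+ 2 / hnorm y ^+ 2)%:C =
    conjc (ip y x) * ip y x / (hnorm y ^+ 2)%:C.
  by rewrite conjcMnorm -fmorphV -rmorphM.
apply: (@complexI R); rewrite -ip_hnorm rmorphB /= qE ipBr !ipBl.
rewrite !ipZr !ipZl rmorphM /= conjc_inv (ip_conj x y).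
rewrite -(ip_hnorm x) (ip_hnorm y) conjcK conjc_real.
by move: (_%:C) n0 => N n0; field.
Qed.

Lemma ip_hnorm_le H (x y : H) : normc (ip x y) <= hnorm x * hnorm y.
Proof.
have [x0|x0] := eqVneq (hnorm x) 0.
  by rewrite (hnorm0_eq0 x0) ip0l normc0 mulr_ge0 ?hnorm_ge0.
rewrite -(@ler_pXn2r _ 2) ?nnegrE ?normc_ge0 ?mulr_ge0 ?hnorm_ge0 //.
have := sqr_ge0 (hnorm (y - (ip x y / ip x x) *: x)).
rewrite hnorm_proj_sqr // subr_ge0 ler_pdivrMr ?exprn_gt0 ?lt_def ?x0 ?hnorm_ge0 //.
by rewrite mulrC exprMn.
Qed.

(** * Convergence and orthogonal projection *)

Lemma normc_real_complex (a : R) : normc a%:C = `|a|.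
Proof. by rewrite /= expr0n addr0 sqrtr_sqr. Qed.

Lemma gt0_complexE (e : R[i]) : 0 < e -> 0 < Re e /\ e = (Re e)%:C.
Proof. by case: e => a b; rewrite ltcE /= => /andP[/eqP -> ->]. Qed.

Lemma cvg_hnormP T (F : set_system T) {FF : Filter F} H (u : T -> H) (l : H) :
  u @ F --> l <-> forall e : R, 0 < e -> \forall t \near F, hnorm (l - u t) < e.
Proof.
split=> [/cvgrPdist_lt ul e e0|ul].
  have : \forall t \near F, `|l - u t| < e%:C by apply: ul; rewrite ltcR.
  by apply: filterS => t; rewrite normE ltcR.
apply/cvgrPdist_lt => e /gt0_complexE[e0 ->].
by apply: filterS (ul _ e0) => t; rewrite normE ltcR.
Qed.

(** The common ending of the approximation arguments below, in which an arbitrarily small error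
    enters with a fixed factor. *)
Lemma le0_of_le_eps (r c : R) : (forall e, 0 < e -> r <= c * e) -> r <= 0.
Proof.
move=> rc; apply/ler_addgt0Pr => e e0; rewrite add0r.
have c1 : 0 < `|c| + 1 by rewrite ltr_wpDl.
have := rc (e / (`|c| + 1)) (divr_gt0 e0 c1).
move/le_trans; apply; rewrite mulrA ler_pdivrMr // mulrC ler_pM2l //.
by rewrite (le_trans (ler_norm c)) // lerDl.
Qed.

Lemma denseP H (D : set H) :
  dense D <-> forall x (e : R), 0 < e -> exists2 y, D y & hnorm (x - y) < e.
Proof.
split=> [dD x e e0|dD O [x Ox] oO].
  have [||y [xy Dy]] := dD (ball x e%:C).
  - by exists x; apply: ballxx; rewrite ltcR.
  - by apply: ball_open; rewrite ltcR.
  - by exists y => //; move: xy; rewrite -ball_normE /= normE ltcR.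
have /nbhs_ballP[e /= /gt0_complexE[e0 ->] xO] := open_nbhs_nbhs (conj oO Ox).
have [y Dy xy] := dD x _ e0; exists y; split=> //.
by apply: xO; rewrite -ball_normE /= normE ltcR.
Qed.

(** Completeness in the form suited to sequences whose terms are chosen with precision
    [n.+1%:R^-1]. *)
Lemma cvgn_harmonic_cauchy H (y : nat -> H) (C : R) :
  (forall m n, hnorm (y m - y n) <= C * (m.+1%:R^-1 + n.+1%:R^-1)) ->
  exists p : H, y @ \oo --> p.
Proof.
move=> yC; apply: (@cvg_ex H _).1 => /=.
apply: cauchy_cvg; apply/cauchyP => e /gt0_complexE[e0 ->].
have c0 : 0 < `|C| * 2 + 1 by rewrite ltr_wpDl // mulr_ge0.
have [N _ hN] := near_infty_natSinv_lt (PosNum (divr_gt0 e0 c0)).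
exists (y N), N => // n /= Nn; rewrite -ball_normE /= normE ltcR.
apply: (le_lt_trans (yC N n)).
have := hN N (leqnn N); have := hN n Nn => /=.
rewrite !ltr_pdivlMr // => h1 h2.
have n1 : 0 <= n.+1%:R^-1 :> R by [].
have n2 : 0 <= N.+1%:R^-1 :> R by [].
have : C * (N.+1%:R^-1 + n.+1%:R^-1) <= `|C| * (N.+1%:R^-1 + n.+1%:R^-1).
  by rewrite ler_wpM2r ?ler_norm ?addr_ge0.
by move: (n.+1%:R^-1) (N.+1%:R^-1) n1 n2 h1 h2 => a b; lra.
Qed.

(** The subspace [D] may fail to be closed, so [p] is placed in its closure, by approximation. It is
    the limit of a sequence in [D] minimising the distance to [x]. *)
Lemma orthogonal_projection H (D : set H) (x : H) : D 0 ->
  (forall a y z, D y -> D z -> D (a *: y + z)) ->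
  exists p, (forall e : R, 0 < e -> exists2 y, D y & hnorm (p - y) < e) /\
    forall y, D y -> ip y (x - p) = 0.
Proof.
move=> D0 DL.
pose E := [set hnorm (x - y) ^+ 2 | y in D].
have Elb : has_lbound E by exists 0 => _ [y _ <-]; exact: sqr_ge0.
have Einf : has_inf E by split=> //; exists (hnorm (x - 0) ^+ 2), 0.
(* The squared tolerance makes the bound in [key] linear in [n.+1%:R^-1], as [cvgn_harmonic_cauchy]
   requires. *)
have /choice[y yP] (n : nat) : exists y, D y /\
    hnorm (x - y) ^+ 2 < inf E + n.+1%:R^-1 ^+ 2.
  have [|_ [y Dy <-] h] := @inf_adherent _ E (n.+1%:R^-1 ^+ 2) _ Einf.
    by rewrite exprn_gt0.
  by exists y.
(* Near-minimality of [y n] along [z] makes [x - y n] almost orthogonal to [z];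
   at [z = y m - y n] this gives the Cauchy property. *)
have key z n : D z -> normc (ip z (x - y n)) <= hnorm z * n.+1%:R^-1.
  move=> Dz; have [z0|z0] := eqVneq (hnorm z) 0.
    by rewrite (hnorm0_eq0 z0) ip0l normc0 hnorm0 mul0r.
  rewrite -(@ler_pXn2r _ 2) ?nnegrE ?normc_ge0 ?mulr_ge0 ?hnorm_ge0 //.
  have z2 : 0 < hnorm z ^+ 2 by rewrite exprn_gt0 // lt_def z0 hnorm_ge0.
  rewrite exprMn mulrC -ler_pdivrMr //.
  have := hnorm_proj_sqr (x - y n) z0; set c := _ / _ => cE.
  have : inf E <= hnorm (x - y n - c *: z) ^+ 2.
    apply: ge_inf => //; exists (c *: z + y n).
      by apply: DL => //; exact: (yP n).1.
    by rewrite opprD addrA addrAC.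
  rewrite cE; move: (yP n).2; move: (hnorm (x - y n) ^+ 2) (inf E) (_ / _).
  by move: (_ ^+ 2) => a b c' d; lra.
have [m n|p yp] := @cvgn_harmonic_cauchy _ y 1.
  rewrite mul1r; have [->|w0] := eqVneq (hnorm (y m - y n)) 0.
    by rewrite addr_ge0.
  have Dw : D (y m - y n).
    by rewrite addrC -scaleN1r; apply: DL; [exact: (yP n).1|exact: (yP m).1].
  have w1 : 0 < hnorm (y m - y n) by rewrite lt_def w0 hnorm_ge0.
  rewrite -(ler_pM2l w1) -expr2 mulrDr.
  have -> : hnorm (y m - y n) ^+ 2 = normc (ip (y m - y n) (y m - y n)).
    by rewrite ip_hnorm normc_real_complex ger0_norm ?sqr_ge0.
  (* As a difference of residuals, the right-hand vector can be estimated by [key] at [n] and at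
     [m]. *)
  rewrite {2}(_ : y m - y n = (x - y n) - (x - y m)); last first.
    by rewrite opprB [RHS]addrC addrA subrK.
  rewrite ipBr addrC; apply: (le_trans (le_normcD _ _)).
  by rewrite normcN lerD // key.
exists p; split=> [e e0|z Dz].
  move/cvg_hnormP: yp => /(_ e e0)[N _ /(_ N (leqnn N)) /= h].
  by exists (y N) => //; exact: (yP N).1.
apply: eq0_normc; apply/eqP; rewrite eq_le normc_ge0 andbT.
apply: (@le0_of_le_eps _ (2 * hnorm z)) => e e0.
move/cvg_hnormP: yp => /(_ e e0)[N _ hN].
have [M _ hM] := near_infty_natSinv_lt (PosNum e0).
pose n := maxn N M.
rewrite -[x - p](subrKA (y n)) ipDr; apply: (le_trans (le_normcD _ _)).
have h1 := key z n Dz.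
have h2 := ip_hnorm_le z (y n - p).
have h3 : hnorm (y n - p) < e by rewrite hdistrC; apply: hN; exact: leq_maxl.
have h4 : n.+1%:R^-1 < e by apply: hM; exact: leq_maxr.
move: (hnorm_ge0 z) h1 h2 h3 h4.
move: (hnorm z) (hnorm (y n - p)) (n.+1%:R^-1) => a b c a0 h1 h2 h3 h4.
have := ler_wpM2l a0 (ltW h3); have := ler_wpM2l a0 (ltW h4).
by move: (normc _) (normc _) h1 h2 => ? ? h1 h2; lra.
Qed.

(** * Bounded operators, adjoints and extension by density *)

(* The linear relation spanned by the pairs [(v i, w i)]; the two families define
   an operator exactly when it is a functional relation. *)
Definition span_graph H K I (v : I -> H) (w : I -> K) (x : H) (y : K) : Prop :=
  exists (n : nat) (c : 'I_n -> R[i]) (i : 'I_n -> I),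
    x = \sum_j c j *: v (i j) /\ y = \sum_j c j *: w (i j).

Lemma lspan_graph H K I (v : I -> H) (w : I -> K) x :
  lspan (range v) x -> exists y, span_graph v w x y.
Proof.
move=> [n [c [z [zv ->]]]].
have /choice[i iP] j : exists k, v k = z j by have [k _ kz] := zv j; exists k.
exists (\sum_j c j *: w (i j)), n, c, i; split=> //.
by apply: eq_bigr => j _; rewrite iP.
Qed.

Lemma span_graph0 H K I (v : I -> H) (w : I -> K) : span_graph v w 0 0.
Proof.
exists 0%N, (fun _ => 0), (fun j : 'I_0 => match notF (ltn_ord j) with end).
by rewrite !big_ord0.
Qed.

Lemma span_graph_gen H K I (v : I -> H) (w : I -> K) i :
  span_graph v w (v i) (w i).
Proof.
by exists 1%N, (fun=> 1), (fun=> i); rewrite !big_ord1 !scale1r.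
Qed.

Lemma span_graph_linear H K I (v : I -> H) (w : I -> K) a x y x' y' :
  span_graph v w x y -> span_graph v w x' y' ->
  span_graph v w (a *: x + x') (a *: y + y').
Proof.
move=> [n [c [i [-> ->]]]] [m [c' [i' [-> ->]]]].
exists (n + m)%N,
  (fun j : 'I_(n + m) =>
     match fintype.split j with inl k => a * c k | inr k => c' k end),
  (fun j : 'I_(n + m) =>
     match fintype.split j with inl k => i k | inr k => i' k end).
rewrite !big_split_ord /= !scaler_sumr; split; congr (_ + _); apply: eq_bigr => j _.
- by rewrite -[lshift _ _]/(unsplit (inl j)) unsplitK scalerA.
- by rewrite -[rshift _ _]/(unsplit (inr j)) unsplitK.
- by rewrite -[lshift _ _]/(unsplit (inl j)) unsplitK scalerA.
- by rewrite -[rshift _ _]/(unsplit (inr j)) unsplitK.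
Qed.

Lemma span_graph_lspan H K I (v : I -> H) (w : I -> K) x y :
  span_graph v w x y -> lspan (range v) x.
Proof.
by move=> [n [c [i [-> _]]]]; exists n, c, (v \o i); split=> // j; exists (i j).
Qed.

(** The residual of [x] after projection onto the closed span is orthogonal to every [v i], so it
    vanishes and [x] lies in the closure. *)
Lemma dense_lspan_range H I (v : I -> H) :
  (forall x, (forall i, ip (v i) x = 0) -> x = 0) -> dense (lspan (range v)).
Proof.
move=> v0; apply/denseP => x e e0.
have [||p [pD px]] := @orthogonal_projection H (lspan (range v)) x.
- exact: span_graph_lspan (span_graph0 v v).
- move=> a y z /(lspan_graph v)[y' yy'] /(lspan_graph v)[z' zz'].
  exact: span_graph_lspan (span_graph_linear a yy' zz').
have -> : x = p.
  apply/eqP; rewrite -subr_eq0; apply/eqP/v0 => i; apply: px.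
  exact: span_graph_lspan (span_graph_gen v v i).
exact: pD.
Qed.

Section linear_map.
Variables (H K : hilbertType R) (A : H -> K).
Hypothesis AL : linear A.

Lemma linear_map0 : A 0 = 0.
Proof. by have := AL (-1) 0 0; rewrite !scaleN1r !addNr. Qed.

Lemma linear_mapD x y : A (x + y) = A x + A y.
Proof. by have := AL 1 x y; rewrite !scale1r. Qed.

Lemma linear_mapZ a x : A (a *: x) = a *: A x.
Proof. by have := AL a x 0; rewrite linear_map0 !addr0. Qed.

Lemma linear_mapB x y : A (x - y) = A x - A y.
Proof. by rewrite addrC -scaleN1r AL scaleN1r addrC. Qed.

Lemma linear_map_sum I (r : seq I) (P : pred I) (F : I -> H) :
  A (\sum_(i <- r | P i) F i) = \sum_(i <- r | P i) A (F i).
Proof. by apply: (big_morph A) => [x y|]; rewrite ?linear_mapD ?linear_map0. Qed.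

End linear_map.

Lemma bounded_opP H K (A : H -> K) : bounded_op A <->
  linear A /\ exists2 M : R, 0 <= M & forall x, hnorm (A x) <= M * hnorm x.
Proof.
split=> -[AL [M]].
  move=> hM; split=> //; exists `|M| => // x.
  have := hM x; rewrite !normE -rmorphM lecR => /le_trans; apply.
  by rewrite ler_wpM2r ?hnorm_ge0 ?ler_norm.
move=> M0 hM; split=> //; exists M => x.
by rewrite !normE -rmorphM lecR.
Qed.

(** A vector outside the kernel of [phi], minus its projection [p] onto the kernel, is orthogonal to
    the kernel; a multiple of it represents [phi]. *)
Lemma riesz_representation H (phi : H -> R[i]) (M : R) :
  (forall a x y, phi (a *: x + y) = a * phi x + phi y) ->
  (forall x, normc (phi x) <= M * hnorm x) ->
  exists z, forall x, ip z x = phi x.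
Proof.
move=> phiL phiM.
have phi0 : phi 0 = 0.
  by have := phiL (-1) 0 0; rewrite scaler0 addr0 mulN1r addNr.
have [h|/existsNP[x0 x00]] := pselect (forall x, phi x = 0).
  by exists 0 => x; rewrite ip0l h.
have [//||p [pD pO]] := @orthogonal_projection H [set x | phi x = 0] x0.
  by move=> a y z /= y0 z0; rewrite phiL y0 z0 mulr0 addr0.
(* The projection is only known to be a limit of kernel elements; boundedness of [phi] puts it in
   the kernel. *)
have p0 : phi p = 0.
  apply: eq0_normc; apply/eqP; rewrite eq_le normc_ge0 andbT.
  apply: (@le0_of_le_eps _ `|M|) => e e0; have [y /= y0 py] := pD e e0.
  have -> : phi p = phi (p - y).
    by rewrite addrC -scaleN1r phiL y0 mulr0 add0r.
  apply: (le_trans (phiM _)); apply: (@le_trans _ _ (`|M| * hnorm (p - y))).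
    by rewrite ler_wpM2r ?hnorm_ge0 ?ler_norm.
  by rewrite ler_wpM2l // ltW.
have phiB a x y : phi (x - a *: y) = phi x - a * phi y.
  by rewrite addrC -scaleNr phiL mulNr addrC.
pose z := x0 - p; have z0 : phi z != 0.
  by rewrite /z -[p]scale1r phiB p0 mulr0 subr0; apply/eqP.
have zz0 : ip z z != 0.
  apply: contra_neq z0 => zz; rewrite (_ : z = 0) ?phi0 //.
  by apply/hnorm0_eq0/eqP; rewrite -sqrf_eq0 hnorm_sqr zz.
(* The vector [x - (phi x / phi z) *: z] lies in the kernel, and its orthogonality to [z] dictates
   this scalar, conjugated because the inner product is conjugate linear on the left. *)
exists (conjc (phi z / ip z z) *: z) => x.
have : ip (x - (phi x / phi z) *: z) z = 0.
  by apply: pO; rewrite /= phiB mulfVK // subrr.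
move=> /(congr1 conjc); rewrite -ip_conj ipBr ipZr rmorph0 => /subr0_eq xz.
by rewrite ipZl conjcK xz; field; rewrite z0 zz0.
Qed.

(** For bounded [A], Riesz representation shows that the [xget] in [adjoint] never falls back on its
    default [0]. *)
Lemma adjointP H K (A : H -> K) : bounded_op A ->
  forall y x, ip (adjoint A y) x = ip y (A x).
Proof.
move=> /bounded_opP[AL [M M0 AM]] y.
rewrite /adjoint; apply: (xgetPex 0 (P := [set z | forall x, ip z x = ip y (A x)])).
apply: (@riesz_representation _ _ (hnorm y * M)) => [a x x'|x].
  by rewrite AL ip_linear.
by rewrite (le_trans (ip_hnorm_le _ _)) // -mulrA ler_wpM2l ?hnorm_ge0.
Qed.

Lemma adjoint_unique H K (A : H -> K) (B : K -> H) :
  (forall y x, ip (B y) x = ip y (A x)) -> adjoint A = B.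
Proof.
move=> AB; apply/funext => y; apply: xget_unique => [//|z zP].
by apply: ip_ext => x; rewrite ip_conj zP -AB -ip_conj.
Qed.

Lemma adjointPr H K (A : H -> K) : bounded_op A ->
  forall x y, ip x (adjoint A y) = ip (A x) y.
Proof. by move=> bA x y; rewrite ip_conj adjointP // -ip_conj. Qed.

Lemma adjoint_linear H K (A : H -> K) : bounded_op A -> linear (adjoint A).
Proof.
by move=> bA a x y; apply: ip_ext => z; rewrite ip_linear !adjointPr // ip_linear.
Qed.

(** With [z = A^* y] one has [|z|^2 = <y, A z> <= |y| M |z|], and [|z|] cancels. *)
Lemma adjoint_hnorm_le H K (A : H -> K) (M : R) : bounded_op A -> 0 <= M ->
  (forall x, hnorm (A x) <= M * hnorm x) ->
  forall y, hnorm (adjoint A y) <= M * hnorm y.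
Proof.
move=> bA M0 AM y; set z := adjoint A y.
have [->|z0] := eqVneq (hnorm z) 0; first by rewrite mulr_ge0 ?hnorm_ge0.
have z1 : 0 < hnorm z by rewrite lt_def z0 hnorm_ge0.
rewrite -(ler_pM2l z1) -expr2 -[_ ^+ 2]ger0_norm ?sqr_ge0 //.
rewrite -normc_real_complex -ip_hnorm adjointP //.
apply: (le_trans (ip_hnorm_le _ _)).
have -> : hnorm z * (M * hnorm y) = hnorm y * (M * hnorm z) by ring.
by apply: ler_wpM2l; rewrite ?hnorm_ge0.
Qed.

Lemma bounded_adjoint H K (A : H -> K) : bounded_op A -> bounded_op (adjoint A).
Proof.
move=> bA; have /bounded_opP[_ [M M0 AM]] := bA; apply/bounded_opP.
by split; [exact: adjoint_linear|exists M => //; exact: adjoint_hnorm_le].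
Qed.

Lemma adjointK H K (A : H -> K) : bounded_op A -> adjoint (adjoint A) = A.
Proof. by move=> bA; apply: adjoint_unique => x y; rewrite adjointPr. Qed.

Lemma bounded_comp H1 H2 H3 (A : H2 -> H3) (B : H1 -> H2) :
  bounded_op A -> bounded_op B -> bounded_op (A \o B).
Proof.
move=> /bounded_opP[AL [M M0 AM]] /bounded_opP[BL [N N0 BN]].
apply/bounded_opP; split=> [a x y /=|]; first by rewrite BL AL.
exists (M * N) => [|x /=]; first exact: mulr_ge0.
by rewrite (le_trans (AM _)) // -mulrA ler_wpM2l.
Qed.

Lemma bounded_op_cvg T (F : set_system T) {FF : Filter F} H K (A : H -> K)
    (u : T -> H) (l : H) : bounded_op A ->
  u @ F --> l -> (fun t => A (u t)) @ F --> A l.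
Proof.
move=> /bounded_opP[AL [M M0 AM]] /cvg_hnormP ul; apply/cvg_hnormP => e e0.
have M1 : 0 < M + 1 by rewrite ltr_wpDl.
apply: filterS (ul _ (divr_gt0 e0 M1)) => t; rewrite ltr_pdivlMr // => ult.
rewrite -linear_mapB //; apply: le_lt_trans (AM _) (le_lt_trans _ ult).
by rewrite mulrC ler_wpM2l ?hnorm_ge0 // lerDl.
Qed.

(** The bound makes the relation functional and carries Cauchy sequences to Cauchy sequences, so the
    value at [x] is the limit along span vectors tending to [x]. *)
Lemma bounded_extension H K I (v : I -> H) (w : I -> K) (M : R) :
  0 <= M -> dense (lspan (range v)) ->
  (forall x y, span_graph v w x y -> hnorm y <= M * hnorm x) ->
  exists A : H -> K, [/\ linear A, forall x, hnorm (A x) <= M * hnorm x &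
    forall i, A (v i) = w i].
Proof.
move=> M0 /denseP vd vw.
have gB x y x' y' : span_graph v w x y -> span_graph v w x' y' ->
    span_graph v w (x - x') (y - y').
  move=> g g'; rewrite addrC -scaleN1r (addrC y) -(scaleN1r y').
  exact: span_graph_linear.
(* An inequality against the whole graph pins down [A x]. Comparison with nearby pairs gives
   linearity, with [(0, 0)] the norm bound, and with [(v i, w i)] the values on generators. *)
have /choice[A AP] (x : H) : exists y : K, forall x' y', span_graph v w x' y' ->
    hnorm (y - y') <= M * hnorm (x - x').
  have /choice[xy xyP] (n : nat) : exists xy : H * K,
      span_graph v w xy.1 xy.2 /\ hnorm (x - xy.1) < n.+1%:R^-1.
    have [|x' /(lspan_graph w)[y' g] xx'] := vd x n.+1%:R^-1; first by [].
    by exists (x', y').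
  have [m n|y hy] := @cvgn_harmonic_cauchy _ (fun n => (xy n).2) M.
    apply: (le_trans (vw _ _ (gB _ _ _ _ (xyP m).1 (xyP n).1))).
    rewrite ler_wpM2l // -[_ - _](subrKA x); apply: (le_trans (ler_hnormD _ _)).
    by rewrite lerD // ltW ?(xyP n).2 // hdistrC (xyP m).2.
  exists y => x' y' g'.
  rewrite -subr_le0; apply: (@le0_of_le_eps _ (1 + M)) => e e0.
  move/cvg_hnormP: hy => /(_ e e0)[N _ hN].
  have [N' _ hN'] := near_infty_natSinv_lt (PosNum e0).
  pose n := maxn N N'.
  have h1 : hnorm (y - (xy n).2) < e by apply: hN; exact: leq_maxl.
  have h2 : hnorm (x - (xy n).1) < e.
    by apply: lt_trans (xyP n).2 _; apply: hN'; exact: leq_maxr.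
  have h3 := vw _ _ (gB _ _ _ _ (xyP n).1 g').
  have h4 : hnorm (y - y') <= hnorm (y - (xy n).2) + hnorm ((xy n).2 - y').
    by rewrite -[y - y'](subrKA (xy n).2) ler_hnormD.
  have h5 : hnorm ((xy n).1 - x') <= hnorm (x - (xy n).1) + hnorm (x - x').
    by rewrite (hdistrC x (xy n).1) -[_ - x'](subrKA x) ler_hnormD.
  rewrite lerBlDr (le_trans h4) // mulrDl mul1r -addrA lerD ?(ltW h1) //.
  rewrite (le_trans h3) // -mulrDr ler_wpM2l // (le_trans h5) //.
  by rewrite lerD2r ltW.
exists A; split=> [a x y|x|i].
- apply/eqP; rewrite -subr_eq0; apply/eqP/hnorm0_eq0/eqP.
  rewrite eq_le hnorm_ge0 andbT.
  (* The error [e] in [x] is multiplied by [normc a] and that in [y] by 1. Both enter twice: through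
     [A (a *: x + y)], and through [A x] and [A y]. *)
  apply: (@le0_of_le_eps _ (2 * (M * (normc a + 1)))) => e e0.
  have [x1 /(lspan_graph w)[y1 g1] xx1] := vd x e e0.
  have [x2 /(lspan_graph w)[y2 g2] xx2] := vd y e e0.
  have h1 := AP (a *: x + y) _ _ (span_graph_linear a g1 g2).
  have h2 := AP x _ _ g1; have h3 := AP y _ _ g2.
  have hx : hnorm (a *: x + y - (a *: x1 + x2)) <= (normc a + 1) * e.
    rewrite opprD addrACA -scalerBr (le_trans (ler_hnormD _ _)) // mulrDl mul1r.
    by rewrite hnormZ lerD // ?(ltW xx2) // ler_wpM2l ?normc_ge0 // ltW.
  rewrite -[_ - _](subrKA (a *: y1 + y2)) (le_trans (ler_hnormD _ _)) //.
  rewrite -mulrA mulr_natl mulr2n lerD //.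
    by rewrite (le_trans h1) // -mulrA ler_wpM2l.
  rewrite hdistrC opprD addrACA -scalerBr (le_trans (ler_hnormD _ _)) //.
  rewrite hnormZ mulrDr mulrDl mulr1 -mulrA mulrCA.
  apply: lerD; last by rewrite (le_trans h3) // ler_wpM2l // ltW.
  by rewrite ler_wpM2l ?normc_ge0 // (le_trans h2) // ler_wpM2l // ltW.
- by have := AP x _ _ (span_graph0 v w); rewrite !subr0.
- apply/eqP; rewrite -subr_eq0; apply/eqP/hnorm0_eq0/eqP.
  rewrite eq_le hnorm_ge0 andbT; have := AP (v i) _ _ (span_graph_gen v w i).
  by rewrite subrr hnorm0 mulr0.
Qed.

Lemma hnorm_le_dense H K (D : set H) (A : H -> K) (M : R) : 0 <= M -> dense D ->
  bounded_op A -> (forall x, D x -> hnorm (A x) <= M * hnorm x) ->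
  forall x, hnorm (A x) <= M * hnorm x.
Proof.
move=> M0 /denseP dD /bounded_opP[AL [N N0 AN]] AM x.
rewrite -subr_le0; apply: (@le0_of_le_eps _ (N + M)) => e e0.
have [y Dy xy] := dD x e e0.
have h1 : hnorm (A x) <= hnorm (A (x - y)) + hnorm (A y).
  by rewrite (linear_mapB AL) -{1}[A x](subrK (A y)) ler_hnormD.
have h2 : hnorm y <= hnorm (x - y) + hnorm x.
  by rewrite hdistrC -{1}[y](subrK x) ler_hnormD.
rewrite lerBlDr (le_trans h1) // mulrDl -addrA lerD //.
  by rewrite (le_trans (AN _)) // ler_wpM2l // ltW.
rewrite (le_trans (AM _ Dy)) // -mulrDr ler_wpM2l // (le_trans h2) //.
by rewrite lerD2r ltW.
Qed.

Lemma bounded_op_eq_dense H K I (v : I -> H) (A B : H -> K) :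
  dense (lspan (range v)) -> bounded_op A -> bounded_op B ->
  (forall i, A (v i) = B (v i)) -> A = B.
Proof.
move=> vd /bounded_opP[AL [M M0 AM]] /bounded_opP[BL [N N0 BN]] AB.
apply/funext => x; apply/eqP; rewrite -subr_eq0; apply/eqP/hnorm0_eq0/eqP.
(* The difference of the operators satisfies the bound with constant 0 on the span, hence
   everywhere. *)
rewrite eq_le hnorm_ge0 andbT -(mul0r (hnorm x)).
move: x; apply: (hnorm_le_dense (A := fun x => A x - B x) (lexx 0) vd).
  apply/bounded_opP; split=> [a x y|].
    by rewrite AL BL scalerBr opprD addrACA.
  exists (M + N) => [|x]; first exact: addr_ge0.
  by rewrite (le_trans (ler_hnormD _ _)) // hnormN mulrDl lerD.
move=> x /(lspan_graph v)[_ [n [c [i [-> _]]]]].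
rewrite mul0r (_ : A _ = B (\sum_j c j *: v (i j))) ?subrr ?hnorm0 //.
rewrite (linear_map_sum AL) (linear_map_sum BL); apply: eq_bigr => j _.
by rewrite (linear_mapZ AL) (linear_mapZ BL) AB.
Qed.

(** Every [w] in the span is orthogonal to [x - y], so [|x - y|^2 = <x - y - w, x - y>], which is
    small for [w] near [x - y]. *)
Lemma dense_ext H I (v : I -> H) : dense (lspan (range v)) ->
  forall x y, (forall i, ip (v i) x = ip (v i) y) -> x = y.
Proof.
move=> /denseP vd x y xy; apply/eqP; rewrite -subr_eq0; apply/eqP/hnorm0_eq0/eqP.
rewrite eq_le hnorm_ge0 andbT; have [->//|z0] := eqVneq (hnorm (x - y)) 0.
apply: (@le0_of_le_eps _ 1) => e e0; rewrite mul1r.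
have z1 : 0 < hnorm (x - y) by rewrite lt_def z0 hnorm_ge0.
have [z /(lspan_graph v)[_ [n [c [i [-> _]]]]]] := vd (x - y) e e0.
set w := \sum_j _ => zw; rewrite -(ler_pM2l z1) -expr2.
have w0 : ip w (x - y) = 0.
  by rewrite ip_suml big1 // => j _; rewrite ipZl ipBr xy subrr mulr0.
rewrite -[_ ^+ 2]ger0_norm ?sqr_ge0 // -normc_real_complex -ip_hnorm.
rewrite -[ip _ _]subr0 -w0 -ipBl (le_trans (ip_hnorm_le _ _)) // mulrC.
by rewrite ler_wpM2l ?hnorm_ge0 // ltW.
Qed.

(** The bound [M] is uniform in [n], so a single approximant from [D] serves all [n]. *)
Lemma cvg_dense H K (D : set H) (A : nat -> H -> K) (M : R) :
  0 <= M -> dense D -> (forall n, linear (A n)) ->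
  (forall n x, hnorm (A n x) <= M * hnorm x) ->
  (forall x, D x -> A ^~ x @ \oo --> (0 : K)) ->
  forall x, A ^~ x @ \oo --> (0 : K).
Proof.
move=> M0 /denseP dD AL AM AD x; apply/cvg_hnormP => e e0.
have M1 : 0 < M + 1 by rewrite ltr_wpDl.
have [y Dy xy] := dD x _ (divr_gt0 e0 (mulr_gt0 (ltr0n R 2) M1)).
move/cvg_hnormP: (AD y Dy) => /(_ (e / 2) (divr_gt0 e0 (ltr0n R 2))).
apply: filterS => n; rewrite !sub0r !hnormN => h.
rewrite -[A n x](subrK (A n y)) -linear_mapB // (le_lt_trans (ler_hnormD _ _)) //.
rewrite [e]splitr ler_ltD // (le_trans (AM _ _)) //.
move: xy; rewrite ltr_pdivlMr ?mulr_gt0 // ler_pdivlMr //.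
move: (hnorm_ge0 (x - y)) (hnorm (x - y)) => + b; nra.
Qed.

(** * Strong sums and orthonormal bases *)

Lemma lspan_ind H (E : set H) (P : H -> Prop) : P 0 ->
  (forall a x y, E x -> P y -> P (a *: x + y)) -> forall x, lspan E x -> P x.
Proof.
move=> P0 PD x [n [c [v [vE ->]]]].
by apply: (big_rec P) => // j y _ Py; exact: PD.
Qed.

Lemma cvg_ip T (F : set_system T) {FF : Filter F} H (x : H) (u : T -> H) (l : H) :
  u @ F --> l -> (fun t => ip x (u t)) @ F --> (ip x l : R[i]).
Proof.
move=> /cvg_hnormP ul; apply/cvgrPdist_lt => e /gt0_complexE[e0 ->].
have x1 : 0 < hnorm x + 1 by rewrite ltr_wpDl ?hnorm_ge0.
apply: filterS (ul _ (divr_gt0 e0 x1)) => t; rewrite ltr_pdivlMr // => ult.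
rewrite normr_normc ltcR -ipBr; apply: le_lt_trans (ip_hnorm_le _ _) _.
by apply: le_lt_trans ult; rewrite mulrC ler_wpM2l ?hnorm_ge0 // lerDl.
Qed.

Lemma cvg_hnorm T (F : set_system T) {FF : Filter F} H (u : T -> H) (l : H) :
  u @ F --> l -> (fun t => hnorm (u t)) @ F --> hnorm l.
Proof.
move=> /cvg_hnormP ul; apply/cvgrPdist_lt => e e0.
apply: filterS (ul _ e0) => t; apply: le_lt_trans.
have h (x y : H) : hnorm x - hnorm y <= hnorm (x - y).
  by rewrite lerBlDr -{1}[x](subrK y) ler_hnormD.
by rewrite ler_norml h andbT lerNl opprB hdistrC h.
Qed.

Lemma cvg_Re T (F : set_system T) {FF : Filter F} (u : T -> R[i]) (l : R[i]) :
  u @ F --> l -> (fun t => Re (u t)) @ F --> Re l.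
Proof.
move=> /cvgrPdist_lt ul; apply/cvgrPdist_lt => e e0.
have := ul e%:C; rewrite ltcR => /(_ e0); apply: filterS => t.
rewrite normr_normc ltcR; apply: le_lt_trans.
by rewrite -raddfB ler_Re_normc.
Qed.

Lemma Re_ip_le H (x y : H) :
  2 * Re (ip x y) <= hnorm x ^+ 2 + hnorm y ^+ 2.
Proof.
have := sqr_ge0 (hnorm (x - y)); rewrite hnormB_sqr.
by move: (hnorm x ^+ 2) (hnorm y ^+ 2) => a b; lra.
Qed.

(** Both sides are continuous in [x], so a strict violation would persist on a nonempty open set and
    hence occur at a point of [D]. *)
Lemma bessel_dense H K (D : set H) (r : seq nat) (P : pred nat)
    (B : nat -> H -> K) : dense D -> (forall i, bounded_op (B i)) ->
  (forall x, D x -> \sum_(i <- r | P i) hnorm (B i x) ^+ 2 <= hnorm x ^+ 2) ->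
  forall x, \sum_(i <- r | P i) hnorm (B i x) ^+ 2 <= hnorm x ^+ 2.
Proof.
move=> dD bB DB x; rewrite leNgt; apply/negP => xB.
pose g (y : H) : R := \sum_(i <- r | P i) hnorm (B i y) ^+ 2 - hnorm y ^+ 2.
have gc : continuous g.
  move=> y; apply: cvgB; last by rewrite /= expr2; apply: cvgM; exact: cvg_hnorm.
  apply: cvg_big => [|i _]; [exact: add_continuous|rewrite expr2].
  by apply: cvgM; apply: cvg_hnorm; apply: bounded_op_cvg.
have [||y [gy /DB]] := dD (g @^-1` [set z | 0 < z]).
- by exists x; rewrite /= subr_gt0.
- by apply: open_comp => [y _|]; [exact: gc|exact: open_gt].
by move: gy; rewrite /= subr_gt0 ltNge => /negP.
Qed.

(* The partial sums [Q n] satisfy [|Q n x|^2 <= S n x := sum_i |B_i x|^2] by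
   AM-GM and the Bessel inequality at [Q n x], whence
   [|x - Q n x|^2 <= |x|^2 - S n x]. *)
Lemma cvg_sum_adjoint H K d (B : nat -> H -> K) (D : set H) :
  dense D -> (forall i, bounded_op (B i)) ->
  (forall x, D x -> (fun n => \sum_(0 <= i < n | index_below d i)
     hnorm (B i x) ^+ 2) @ \oo --> hnorm x ^+ 2) ->
  sot_sum d (fun i => adjoint (B i) \o B i) idfun.
Proof.
move=> dD bB BD x.
pose S n x := \sum_(0 <= i < n | index_below d i) hnorm (B i x) ^+ 2.
pose Q n x := \sum_(0 <= i < n | index_below d i) adjoint (B i) (B i x).
have S_le n z : S n z <= hnorm z ^+ 2.
  move: z; apply: bessel_dense dD bB _ => z Dz.
  rewrite -(cvg_lim _ (BD z Dz)) //.
  apply: (nondecreasing_cvgn_le (u_ := S ^~ z)); last exact: cvgP (BD z Dz).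
  by apply: nondecreasing_series => i _ _; exact: sqr_ge0.
have QL n : linear (Q n).
  move=> a y z; rewrite scaler_sumr -big_split /=; apply: eq_bigr => i _.
  have /bounded_opP[BL _] := bB i.
  by rewrite BL (adjoint_linear (bB i)).
have ipQ n y z : ip y (Q n z) =
    \sum_(0 <= i < n | index_below d i) ip (B i y) (B i z).
  by rewrite ip_sumr; apply: eq_bigr => i _; rewrite adjointPr.
have Re_ipQ n y z : 2 * Re (ip y (Q n z)) <= S n y + S n z.
  rewrite ipQ raddf_sum mulr_sumr -big_split /=.
  by apply: ler_sum => i _; exact: Re_ip_le.
have Q_le n z : hnorm (Q n z) ^+ 2 <= S n z.
  have := Re_ipQ n (Q n z) z; have := S_le n (Q n z); rewrite -hnorm_sqr.
  by move: (_ ^+ 2) (S _ _) (S _ _) => a b c; lra.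
have key n z : hnorm (z - Q n z) ^+ 2 <= hnorm z ^+ 2 - S n z.
  rewrite hnormB_sqr ipQ raddf_sum.
  rewrite (eq_bigr (fun i => hnorm (B i z) ^+ 2)) => [|i _]; last exact/esym/hnorm_sqr.
  have := Q_le n z; rewrite -/(S n z).
  by move: (_ ^+ 2) (_ ^+ 2) (S _ _) => a b c; lra.
suff : (fun n => x - Q n x) @ \oo --> (0 : H).
  move=> /cvg_hnormP h; apply/cvg_hnormP => e e0.
  by apply: filterS (h e e0) => n; rewrite sub0r hnormN.
move: x; apply: (cvg_dense (A := fun n x => x - Q n x) ler01 dD).
- by move=> n a y z; rewrite QL scalerBr opprD addrACA.
- move=> n z; rewrite mul1r -(@ler_pXn2r _ 2) ?nnegrE ?hnorm_ge0 //.
  rewrite (le_trans (key n z)) // gerBl sumr_ge0 // => i _; exact: sqr_ge0.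
move=> z Dz; apply/cvg_hnormP => e e0.
move/cvgrPdist_lt: (BD z Dz) => /(_ (e ^+ 2) (exprn_gt0 _ e0)).
apply: filterS => n h; rewrite sub0r hnormN.
rewrite -(@ltr_pXn2r _ 2) ?nnegrE ?hnorm_ge0 ?(ltW e0) //.
by rewrite (le_lt_trans (key n z)) // (le_lt_trans (ler_norm _)).
Qed.

Section orthonormal_basis.
Variables (K : hilbertType R) (d : option nat) (u : nat -> K).
Hypothesis ub : orthonormal_basis d u.

Let proj n y := \sum_(0 <= i < n | index_below d i) ip (u i) y *: u i.

Let ip_proj n j y : (j < n)%N -> index_below d j -> ip (u j) (proj n y) = ip (u j) y.
Proof.
move=> jn dj; rewrite ip_sumr big_mkcond (bigD1_seq j) ?mem_index_iota ?iota_uniq //=.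
rewrite dj ipZr ub.1 // eqxx mulr1 big1 ?addr0 // => i ij.
by case: ifP => // di; rewrite ipZr ub.1 // eq_sym (negbTE ij) mulr0.
Qed.

(** The partial sums are contractions, so the remainders are bounded by 2 uniformly in [n].
    Convergence then needs checking only on the span, where each basis vector is eventually
    reproduced exactly. *)
Lemma onb_expansion y : proj ^~ y @ \oo --> y.
Proof.
have projL n : linear (proj n).
  move=> a x z; rewrite scaler_sumr -big_split /=; apply: eq_bigr => i _.
  by rewrite ip_linear scalerDl scalerA.
have proj_le n x : hnorm (proj n x) <= hnorm x.
  have [->|p0] := eqVneq (hnorm (proj n x)) 0; first exact: hnorm_ge0.
  have p1 : 0 < hnorm (proj n x) by rewrite lt_def p0 hnorm_ge0.
  rewrite -(ler_pM2l p1) -expr2 -[_ ^+ 2]ger0_norm ?sqr_ge0 //.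
  rewrite -normc_real_complex -ip_hnorm.
  (* Since [proj n] is an orthogonal projection, Cauchy-Schwarz against [x] itself yields the
     contraction bound. *)
  have -> : ip (proj n x) (proj n x) = ip (proj n x) x; last exact: ip_hnorm_le.
  rewrite !ip_suml big_nat_cond [RHS]big_nat_cond.
  by apply: eq_bigr => i /andP[/= ni di]; rewrite !ipZl ip_proj.
suff : (fun n => y - proj n y) @ \oo --> (0 : K).
  move=> /cvg_hnormP h; apply/cvg_hnormP => e e0.
  by apply: filterS (h e e0) => n; rewrite sub0r hnormN.
move: y; apply: (cvg_dense (A := fun n x => x - proj n x) (M := 2) _ ub.2) => //.
- by move=> n a x z; rewrite projL scalerBr opprD addrACA.
- move=> n x; rewrite (le_trans (ler_hnormD _ _)) // hnormN mulrDl mul1r.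
  by rewrite lerD2l.
apply: lspan_ind => [|a _ x [m dm <-] xP].
  under eq_fun do rewrite (linear_map0 (projL _)) subr0; exact: cvg_cst.
have umP : (fun n => u m - proj n (u m)) @ \oo --> (0 : K).
  (* The index [m] enters the sum over [i < n] from [n = m.+1] on, and from there the remainder is
     zero. *)
  apply/cvg_hnormP => e e0; exists m.+1 => // n /= mn.
  suff -> : proj n (u m) = u m by rewrite !subrr hnorm0.
  rewrite /proj big_mkcond (bigD1_seq m) ?mem_index_iota ?iota_uniq //=.
  rewrite dm ub.1 // eqxx scale1r big1 ?addr0 // => i im.
  by case: ifP => // di; rewrite ub.1 // (negbTE im) scale0r.
rewrite (_ : (fun n => _) = (fun n => a *: (u m - proj n (u m)) + (x - proj n x))).
  rewrite -[X in _ --> X]addr0 -{1}(scaler0 K a).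
  by apply: cvgD => //; apply: cvgZl_tmp.
by apply/funext => n; rewrite projL scalerBr opprD addrACA.
Qed.

Lemma parseval y z :
  (fun n => \sum_(0 <= i < n | index_below d i) conjc (ip (u i) y) * ip (u i) z)
    @ \oo --> (ip y z : R[i]).
Proof.
rewrite (_ : (fun n => _) = fun n => ip y (proj n z)).
  exact: cvg_ip (@onb_expansion z).
apply/funext => n; rewrite ip_sumr; apply: eq_bigr => i _.
by rewrite ipZr mulrC -ip_conj.
Qed.

(** Expanding the squares and exchanging finite sums leaves one Parseval sum for each pair [i, j].
    Both strong sums below rest on this identity, with kernel functions or with tensor factors as
    the vectors. *)
Lemma parseval_gram H m (x : 'I_m -> H) (y : 'I_m -> K) :
  (fun n => \sum_(0 <= a < n | index_below d a)
     hnorm (\sum_i ip (u a) (y i) *: x i) ^+ 2) @ \oo -->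
  Re (\sum_i \sum_j ip (x i) (x j) * ip (y i) (y j)).
Proof.
have h : (fun n => \sum_i \sum_j ip (x i) (x j) *
      \sum_(0 <= a < n | index_below d a)
        conjc (ip (u a) (y i)) * ip (u a) (y j)) @ \oo -->
    (\sum_i \sum_j ip (x i) (x j) * ip (y i) (y j) : R[i]).
  apply: cvg_big => [|i _]; first exact: add_continuous.
  apply: cvg_big => [|j _]; first exact: add_continuous.
  by apply: cvgMl_tmp; exact: parseval.
rewrite (_ : (fun n => _) = fun n => Re (\sum_i \sum_j ip (x i) (x j) *
      \sum_(0 <= a < n | index_below d a)
        conjc (ip (u a) (y i)) * ip (u a) (y j))); first exact: cvg_Re h.
apply/funext => n; under [LHS]eq_bigr do rewrite hnorm_sqr.
rewrite -raddf_sum; congr Re.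
under [RHS]eq_bigr do under eq_bigr do rewrite mulr_sumr.
under [RHS]eq_bigr do rewrite exchange_big.
rewrite [RHS]exchange_big; apply: eq_bigr => a _.
rewrite ip_suml; apply: eq_bigr => i _; rewrite ip_sumr; apply: eq_bigr => j _.
by rewrite ipZl ipZr; ring.
Qed.

End orthonormal_basis.

(** * Weighted composition operators *)

Lemma isometric_extension H K I (v : I -> H) (w : I -> K) :
  dense (lspan (range v)) -> (forall i j, ip (w i) (w j) = ip (v i) (v j)) ->
  exists V : H -> K, [/\ linear V, forall x, hnorm (V x) = hnorm x &
    forall i, V (v i) = w i].
Proof.
move=> vd vw; have [|V [VL V1 Vv]] := bounded_extension (w := w) ler01 vd.
  move=> x y [n [c [i [-> ->]]]].
  rewrite mul1r -(@ler_pXn2r _ 2) ?nnegrE ?hnorm_ge0 // !hnorm_sqr !ip_suml.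
  rewrite le_eqVlt; apply/orP; left; apply/eqP; congr Re.
  apply: eq_bigr => j _; rewrite !ip_sumr; apply: eq_bigr => k _.
  by rewrite !ipZl !ipZr vw.
have bV : bounded_op V by apply/bounded_opP; split=> //; exists 1.
(* The extension by itself yields only [|V x| <= |x|]; the identity [V^* V = id], checked on the
   generators, turns this into equality. *)
have VK : adjoint V \o V = id.
  apply: (bounded_op_eq_dense vd).
  - by apply: bounded_comp => //; exact: bounded_adjoint.
  - by apply/bounded_opP; split=> //; exists 1 => // x; rewrite mul1r.
  move=> i; apply: (dense_ext vd) => j /=.
  by rewrite adjointPr // !Vv vw.
exists V; split=> // x; apply/eqP.
rewrite -(@eqrXn2 _ 2) ?hnorm_ge0 // !hnorm_sqr -adjointPr //.
by rewrite -[adjoint V _]/((adjoint V \o V) x) VK.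
Qed.

(** * Density of the kernel functions in a reproducing kernel Hilbert space *)

Section rkhs_theory.
Variables (X : Type) (k : X -> X -> R[i]) (Hk : rkhs k).

Lemma ip_kfun w z : ip (kfun Hk w) (kfun Hk z) = k w z.
Proof. by rewrite -feval_reproducing feval_kfun. Qed.

Lemma rkhs_ext (g h : Hk) : (forall w, feval g w = feval h w) -> g = h.
Proof. by move=> gh; apply: feval_inj; apply/funext. Qed.

Lemma dense_kfun : dense (lspan (range (kfun Hk))).
Proof.
apply: dense_lspan_range => x x0; apply: rkhs_ext => w.
by rewrite !feval_reproducing x0 ip0r.
Qed.

End rkhs_theory.

(** The [n]-th Taylor coefficient of the vector on the left is [<u, sum_i x_i(n) y_i>], while the
    Gram sum equals [sum_n |sum_i x_i(n) y_i|^2]. *)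
Lemma hardy_schur K m (x : 'I_m -> hardy R) (y : 'I_m -> K) (u : K) :
  hnorm (\sum_i ip u (y i) *: x i) ^+ 2 <=
  hnorm u ^+ 2 * Re (\sum_i \sum_j ip (x i) (x j) * ip (y i) (y j)).
Proof.
pose z := \sum_i ip u (y i) *: x i; rewrite -/z.
(* The Gram sum with every Hardy inner product cut off after [N] coefficients, so that all sums are
   finite and can be exchanged. *)
pose g N := Re (\sum_i \sum_j
  series (fun n => conjc (x i n) * x j n) N * ip (y i) (y j)).
have gc : g @ \oo --> Re (\sum_i \sum_j ip (x i) (x j) * ip (y i) (y j)).
  apply: cvg_Re; apply: cvg_big => [|i _]; first exact: add_continuous.
  apply: cvg_big => [|j _]; first exact: add_continuous.
  by apply: cvgMr_tmp; exact: hardy_ip_cvg.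
have -> : hnorm z ^+ 2 = limn (series (fun n => normc (z n) ^+ 2)).
  by apply: (@complexI R); rewrite -hardy_norm_sqr normE rmorphXn.
rewrite -subr_ge0.
apply: (cvgr_to_ge (cvgB (cvgMl_tmp (a := hnorm u ^+ 2) gc) (@coefP R z))).
apply: nearW => N; rewrite subr_ge0.
rewrite /g /series /= .
have -> : \sum_i \sum_j (\sum_(0 <= n < N) conjc (x i n) * x j n) * ip (y i) (y j) =
    \sum_(0 <= n < N) ip (\sum_i x i n *: y i) (\sum_i x i n *: y i).
  under [LHS]eq_bigr do under eq_bigr do rewrite mulr_suml.
  under [LHS]eq_bigr do rewrite exchange_big.
  rewrite [LHS]exchange_big; apply: eq_bigr => n _.
  rewrite ip_suml; apply: eq_bigr => i _; rewrite ip_sumr; apply: eq_bigr => j _.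
  by rewrite ipZl ipZr mulrA.
rewrite raddf_sum mulr_sumr; apply: ler_sum => n _.
have -> : z n = ip u (\sum_i x i n *: y i).
  rewrite /z (big_morph (fun a : hardy R => a n) (fun a b => hardyD a b n) (erefl _)).
  by rewrite ip_sumr; apply: eq_bigr => i _; rewrite hardyZ ipZr mulrC.
rewrite /= -hnorm_sqr -exprMn.
by rewrite ler_pXn2r ?nnegrE ?normc_ge0 ?mulr_ge0 ?hnorm_ge0 ?ip_hnorm_le.
Qed.

Section weighted_composition.
Variables (f : disk R -> disk R) (Hf : rkhs (dbr_kernel f)).
Implicit Type u : Hf.

Lemma szego_dbr_kernel (z w : disk R) :
  szego (f z) (f w) * dbr_kernel f z w = szego z w.
Proof.
rewrite /szego /dbr_kernel !div1r mulrA mulVf ?mul1r //.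
rewrite subr_eq0; apply/negP => /eqP q1.
have : normc (val (f z) * conjc (val (f w))) < 1.
  by rewrite normcM normc_conjc mulr_ilt1 ?normc_ge0 ?normc_disk.
by rewrite -q1 normc1 ltxx.
Qed.

Local Notation k := (kfun (hardy_rkhs R)).

Lemma gram_kfun n (c : 'I_n -> R[i]) (w : 'I_n -> disk R) :
  \sum_i \sum_j ip (c i *: k (f (w i))) (c j *: k (f (w j))) *
    ip (kfun Hf (w i)) (kfun Hf (w j)) =
  ip (\sum_i c i *: k (w i)) (\sum_i c i *: k (w i)).
Proof.
rewrite ip_suml; apply: eq_bigr => i _; rewrite ip_sumr; apply: eq_bigr => j _.
by rewrite !ipZl !ipZr !ip_kfun -(szego_dbr_kernel (w i)) !mulrA.
Qed.

(** Elements of the Hardy space are determined by their values, so an operator with the prescribed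
    values is the one selected by [xget]. *)
Lemma weighted_comp_unique u (A : hardy_rkhs R -> hardy_rkhs R) :
  (forall h z, feval (A h) z = feval u z * feval h (f z)) -> weighted_comp u = A.
Proof.
move=> AP; apply/funext => h; apply: xget_unique => [z|g gP]; first exact: AP.
by apply: rkhs_ext => z; rewrite gP AP.
Qed.

(** The operator [W_u] is obtained from its adjoint: [B] is prescribed on kernels and bounded on
    their span, and evaluating its adjoint at [z] produces [u(z) h(f z)]. In particular [u (h o f)]
    does lie in the Hardy space. *)
Lemma weighted_comp_adjoint u : exists B : hardy_rkhs R -> hardy_rkhs R,
  [/\ bounded_op B, forall x, hnorm (B x) <= hnorm u * hnorm x,
    forall w, B (k w) = ip u (kfun Hf w) *: k (f w) & weighted_comp u = adjoint B].
Proof.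
have [|B [BL Bu Bk]] := bounded_extension (H := hardy_rkhs R)
  (w := fun w => ip u (kfun Hf w) *: k (f w)) (hnorm_ge0 u)
  (@dense_kfun _ _ (hardy_rkhs R)).
  move=> _ _ [n [c [w [-> ->]]]].
  rewrite -(@ler_pXn2r _ 2) ?nnegrE ?mulr_ge0 ?hnorm_ge0 // exprMn.
  rewrite [X in _ * X]hnorm_sqr -gram_kfun.
  (* The coefficient [c i] is absorbed into the Hardy vector, matching the Gram sum in
     [gram_kfun]. *)
  under eq_bigr do rewrite scalerA mulrC -scalerA.
  exact: (@hardy_schur Hf n (fun i => c i *: k (f (w i))) (kfun Hf \o w)).
have bB : bounded_op B.
  by apply/bounded_opP; split=> //; exists (hnorm u) => //; exact: hnorm_ge0.
exists B; split=> //; apply: weighted_comp_unique => h z.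
rewrite !feval_reproducing adjointPr // Bk ipZl -ip_conj.
by rewrite -feval_reproducing.
Qed.

Lemma weighted_compE u h z :
  feval (weighted_comp u h) z = feval u z * feval h (f z).
Proof.
have [B [bB _ Bk ->]] := weighted_comp_adjoint u.
by rewrite !feval_reproducing adjointPr // Bk ipZl -ip_conj.
Qed.

Lemma hnorm_weighted_comp_le u h :
  hnorm (weighted_comp u h) <= hnorm u * hnorm h.
Proof.
have [B [bB Bu _ ->]] := weighted_comp_adjoint u.
by apply: adjoint_hnorm_le => //; exact: hnorm_ge0.
Qed.

Lemma bounded_weighted_comp u : bounded_op (weighted_comp u).
Proof.
by have [B [bB _ _ ->]] := weighted_comp_adjoint u; exact: bounded_adjoint.
Qed.

Lemma opnorm_weighted_comp_le u : opnorm (weighted_comp u) <= hnorm u.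
Proof.
apply: ge_sup; first by exists (hnorm (weighted_comp u 0)), 0 => //=; rewrite hnorm0.
move=> _ [h /= h1 <-]; rewrite (le_trans (hnorm_weighted_comp_le u h)) //.
by rewrite ler_piMr ?hnorm_ge0.
Qed.

Lemma adjoint_weighted_comp_kfun u w :
  adjoint (weighted_comp u) (k w) = ip u (kfun Hf w) *: k (f w).
Proof.
by have [B [bB _ Bk ->]] := weighted_comp_adjoint u; rewrite adjointK.
Qed.

Lemma weighted_comp_sum_id d (u : nat -> Hf) : orthonormal_basis d u ->
  sot_sum d (fun n => weighted_comp (u n) \o adjoint (weighted_comp (u n))) idfun.
Proof.
move=> ub; have bW n := bounded_adjoint (bounded_weighted_comp (u n)).
(* To fit the pattern [B^* B] of [cvg_sum_adjoint] with [B = W_u^*], the factor [W_u] is written as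
   a double adjoint. *)
rewrite (_ : (fun n => _) = fun n =>
    adjoint (adjoint (weighted_comp (u n))) \o adjoint (weighted_comp (u n))).
  2: by apply/funext => n; rewrite adjointK //; exact: bounded_weighted_comp.
apply: (cvg_sum_adjoint (@dense_kfun _ _ (hardy_rkhs R)) bW).
move=> x /(lspan_graph (kfun Hf))[_ [n [c [w [-> _]]]]].
rewrite hnorm_sqr -gram_kfun.
rewrite (_ : (fun m => _) = fun m => \sum_(0 <= a < m | index_below d a)
    hnorm (\sum_i ip (u a) (kfun Hf (w i)) *: (c i *: k (f (w i)))) ^+ 2).
  exact: (@parseval_gram _ _ _ ub _ _ (fun i => c i *: k (f (w i))) (kfun Hf \o w)).
apply/funext => m; apply: eq_bigr => a _; congr (hnorm _ ^+ 2).
have /bounded_opP[WL _] := bW a.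
rewrite (linear_map_sum WL); apply: eq_bigr => i _.
by rewrite (linear_mapZ WL) adjoint_weighted_comp_kfun !scalerA mulrC.
Qed.

End weighted_composition.

(** * Tensor products and the dilation *)

Section tensor_product.
Variables (H K : hilbertType R) (T : hilbert_tensor H K).

Let simple_tensor (xy : H * K) := tens T xy.1 xy.2.

Lemma dense_simple_tensor : dense (lspan (range simple_tensor)).
Proof. exact: tens_dense. Qed.

Lemma hnorm_sum_tensor n (c : 'I_n -> R[i]) (x : 'I_n -> H) (y : 'I_n -> K) :
  hnorm (\sum_i c i *: tens T (x i) (y i)) ^+ 2 =
  Re (\sum_i \sum_j ip (c i *: x i) (c j *: x j) * ip (y i) (y j)).
Proof.
rewrite hnorm_sqr ip_suml; congr Re; apply: eq_bigr => i _.
rewrite ip_sumr; apply: eq_bigr => j _.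
by rewrite !ipZl !ipZr tens_ip !mulrA.
Qed.

Lemma bounded_tensl (y : K) : bounded_op (fun x => tens T x y).
Proof.
apply/bounded_opP; split; first exact: tens_linearl.
exists (hnorm y) => [|x]; first exact: hnorm_ge0.
rewrite -(@ler_pXn2r _ 2) ?nnegrE ?mulr_ge0 ?hnorm_ge0 // exprMn.
rewrite hnorm_sqr tens_ip !ip_hnorm mulrC -rmorphM.
exact: lexx.
Qed.

Lemma adjoint_tensl (u : K) x y :
  adjoint (fun z => tens T z u) (tens T x y) = ip u y *: x.
Proof.
apply: ip_ext => z.
by rewrite (adjointPr (bounded_tensl u)) tens_ip ipZr mulrC.
Qed.

Variables (d : option nat) (u : nat -> K).
Hypothesis ub : orthonormal_basis d u.

(** The terms are the squared norms of the slices of the tensor along the basis vectors [u a], that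
    is, of its images under the adjoints of [x |-> x (x) u a]. *)
Lemma parseval_tensor n (c : 'I_n -> R[i]) (x : 'I_n -> H) (y : 'I_n -> K) :
  (fun m => \sum_(0 <= a < m | index_below d a)
     hnorm (\sum_i c i *: (ip (u a) (y i) *: x i)) ^+ 2) @ \oo -->
  hnorm (\sum_i c i *: tens T (x i) (y i)) ^+ 2.
Proof.
rewrite hnorm_sum_tensor.
rewrite (_ : (fun m => _) = fun m => \sum_(0 <= a < m | index_below d a)
    hnorm (\sum_i ip (u a) (y i) *: (c i *: x i)) ^+ 2).
  exact: (@parseval_gram _ _ _ ub _ _ (fun i => c i *: x i) y).
apply/funext => m; apply: eq_bigr => a _; congr (hnorm _ ^+ 2).
by apply: eq_bigr => i _; rewrite !scalerA mulrC.
Qed.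

Lemma tensor_sum_id :
  sot_sum d (fun a => (fun x => tens T x (u a)) \o adjoint (fun x => tens T x (u a)))
    (@idfun T).
Proof.
rewrite (_ : (fun a => _) = fun a =>
    adjoint (adjoint (fun x => tens T x (u a))) \o adjoint (fun x => tens T x (u a))).
  2: by apply/funext => a; rewrite adjointK //; exact: bounded_tensl.
apply: (cvg_sum_adjoint dense_simple_tensor) => [a|].
  exact: bounded_adjoint (bounded_tensl (u a)).
move=> _ /(lspan_graph simple_tensor)[_ [n [c [xy [-> _]]]]].
rewrite (_ : (fun m => _) = fun m => \sum_(0 <= a < m | index_below d a)
    hnorm (\sum_i c i *: (ip (u a) (xy i).2 *: (xy i).1)) ^+ 2).
  exact: (@parseval_tensor _ c (fun i => (xy i).1) (fun i => (xy i).2)).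
apply/funext => m; apply: eq_bigr => a _; congr (hnorm _ ^+ 2).
have L := adjoint_linear (bounded_tensl (u a)).
rewrite (linear_map_sum L); apply: eq_bigr => i _.
by rewrite (linear_mapZ L) adjoint_tensl.
Qed.

(** Existence rests on a bound over the span of simple tensors. On each slice along [u a] the
    operator acts as [S], so the bound [M] holds slice by slice, and [parseval_tensor] adds up the
    slices. *)
Lemma ampliationP (S : H -> H) : bounded_op S ->
  bounded_op (ampliation (T := T) S) /\
  forall x y, ampliation S (tens T x y) = tens T (S x) y.
Proof.
move=> /bounded_opP[SL [M M0 SM]].
apply: (xgetPex (fun=> 0) (P := [set A : T -> T |
  bounded_op A /\ forall x y, A (tens T x y) = tens T (S x) y])).
have [|A [AL AM AS]] := bounded_extension
    (w := fun xy => tens T (S xy.1) xy.2) M0 dense_simple_tensor.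
  move=> _ _ [n [c [xy [-> ->]]]].
  rewrite -(@ler_pXn2r _ 2) ?nnegrE ?mulr_ge0 ?hnorm_ge0 // exprMn -subr_ge0.
  have h1 := @parseval_tensor _ c (fun i => (xy i).1) (fun i => (xy i).2).
  have h2 := @parseval_tensor _ c (fun i => S (xy i).1) (fun i => (xy i).2).
  apply: (cvgr_to_ge (cvgB (cvgMl_tmp (a := M ^+ 2) h1) h2)).
  apply: nearW => m; rewrite subr_ge0 mulr_sumr; apply: ler_sum => a _.
  have -> : \sum_i c i *: (ip (u a) (xy i).2 *: S (xy i).1) =
      S (\sum_i c i *: (ip (u a) (xy i).2 *: (xy i).1)).
    rewrite (linear_map_sum SL); apply: eq_bigr => i _.
    by rewrite !(linear_mapZ SL).
  by rewrite -exprMn ler_pXn2r ?nnegrE ?mulr_ge0 ?hnorm_ge0.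
exists A; split; first by apply/bounded_opP; split=> //; exists M.
by move=> x y; rewrite (AS (x, y)).
Qed.

End tensor_product.

(** * The isometry [V_f] and the formula for [Phi_f] *)

Section dbr_operators.
Variables (f : disk R -> disk R) (Hf : rkhs (dbr_kernel f)).
Variable T : hilbert_tensor (hardy_rkhs R) Hf.
Local Notation k := (kfun (hardy_rkhs R)).
Local Notation V := (@dbr_isometry R f Hf T).

(** By [szego_dbr_kernel] the vectors [k_{f(w)} (x) c_{f,w}] have the same Gram matrix as the [k_w],
    whose span is dense. *)
Lemma dbr_isometryP : [/\ linear V, forall h, `|V h| = `|h| &
  forall w, V (k w) = tens T (k (f w)) (kfun Hf w)].
Proof.
apply: (xgetPex (fun=> 0) (P := [set V : hardy_rkhs R -> T | [/\ linear V,
    forall h, `|V h| = `|h| & forall w, V (k w) = tens T (k (f w)) (kfun Hf w)]])).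
have [|V0 [V0L V01 V0k]] := isometric_extension
    (w := fun w => tens T (k (f w)) (kfun Hf w)) (@dense_kfun _ _ (hardy_rkhs R)).
  by move=> w z; rewrite tens_ip !ip_kfun szego_dbr_kernel.
by exists V0; split=> // h; rewrite !normE V01.
Qed.

Lemma bounded_dbr_isometry : bounded_op V.
Proof.
have [VL V1 _] := dbr_isometryP; split=> //.
by exists 1 => h; rewrite V1 mul1r.
Qed.

(** Pairing [h (x) u] with [V k_z = k_{f(z)} (x) c_{f,z}] gives the product of evaluations
    [h(f z) u(z)]. *)
Lemma weighted_comp_dilation (u : Hf) :
  weighted_comp u = fun h => adjoint V (tens T h u).
Proof.
have [_ _ Vk] := dbr_isometryP; apply: weighted_comp_unique => h z.
rewrite !feval_reproducing (adjointPr bounded_dbr_isometry) Vk tens_ip.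
by rewrite mulrC.
Qed.

Lemma adjoint_weighted_comp_dilation (u : Hf) :
  adjoint (weighted_comp u) = adjoint (fun h => tens T h u) \o V.
Proof.
apply: adjoint_unique => y x /=; rewrite weighted_comp_dilation /=.
by rewrite (adjointP (bounded_tensl _ u)) (adjointPr bounded_dbr_isometry).
Qed.

(** The bounded operator [V_f^* (S (x) I)] is applied to the expansion of [V x] given by
    [tensor_sum_id]; continuity carries the limit through, and each term becomes [W_u S W_u^* x]. *)
Lemma weighted_comp_sum_dbr_cp d (u : nat -> Hf) S :
  orthonormal_basis d u -> bounded_op S ->
  sot_sum d (fun n => weighted_comp (u n) \o S \o adjoint (weighted_comp (u n)))
    (dbr_cp T S).
Proof.
move=> ub bS x; have [bA AS] := ampliationP T ub bS.
have bVA := bounded_comp (bounded_adjoint bounded_dbr_isometry) bA.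
rewrite (_ : (fun n => _) = fun n => (adjoint V \o ampliation S)
    (\sum_(0 <= i < n | index_below d i)
      tens T (adjoint (fun h => tens T h (u i)) (V x)) (u i))).
  exact: (bounded_op_cvg bVA (@tensor_sum_id _ _ T _ _ ub (V x))).
apply/funext => n; have /bounded_opP[VAL _] := bVA.
rewrite (linear_map_sum VAL); apply: eq_bigr => i _ /=.
by rewrite AS adjoint_weighted_comp_dilation {1}weighted_comp_dilation.
Qed.

End dbr_operators.

End hilbert_space.

Theorem proposition4p4 (R : realType) (f : disk R -> disk R)
    (hf : holomorphic (fun z => val (f z))) (Hf : rkhs (dbr_kernel f)) :
  (forall u : Hf,
    [/\ forall (h : hardy_rkhs R) (z : disk R),
          feval (weighted_comp u h) z = feval u z * feval h (f z),
        bounded_op (weighted_comp u) &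
        opnorm (weighted_comp u) <= hnorm u]) /\
  (forall (d : option nat) (u : nat -> Hf), orthonormal_basis d u ->
    (forall (T : hilbert_tensor (hardy_rkhs R) Hf)
        (S : hardy_rkhs R -> hardy_rkhs R), bounded_op S ->
      sot_sum d (fun n => weighted_comp (u n) \o S \o adjoint (weighted_comp (u n)))
        (dbr_cp T S)) /\
    sot_sum d (fun n => weighted_comp (u n) \o adjoint (weighted_comp (u n))) idfun).
Proof.
split=> [u|d u ub].
  split; [exact: weighted_compE|exact: bounded_weighted_comp|].
  exact: opnorm_weighted_comp_le.
split=> [T S bS|]; first exact: weighted_comp_sum_dbr_cp.
exact: weighted_comp_sum_id.
Qed.
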